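(* Let $p$ be a prime and $\lambda\ge0$ an integer. The number of isomorphism classes of rings with property (T), of characteristic $p$, with maximal Galois subfield $\mathbf F_p$ and invariants $p,n,s,t,\lambda$ with $s=2$ and $t=2$ is $$\begin{cases}10 & \text{if } p=2,\\ 3p+5 & \text{if } p\ne2.\end{cases}$$ Of these isomorphism classes, exactly $3$ (for every prime $p$) consist of commutative rings; the others are non-commutative.
   Context: All rings are finite, associative, with identity. A finite ring $R$ has property (T) if the set $M$ of all its zero-divisors (including $0$) is an ideal (so $R$ is completely primary with Jacobson radical $M$), $M^3=0$ and $M^2\ne 0$. Compatible matrices: for a finite field $F$, matrices $A_k=(a^k_{ij})\in M_s(F)$, $1\le k\le t$, are called compatible if they are linearly independent over $F$ and for each $i\in\{1,\dots,s\}$ there are $j,k$ with $a^k_{ij}\ne0$ or $a^k_{ji}\neq 0$. Since the maximal Galois subfield is $F=\mathbf F_p$ (i.e. $R/M\cong\mathbf F_p$), all field automorphisms are trivial, and the rings in question are those isomorphic to rings of the following form (Construction A with $F=\mathbf F_p$): for $s\ge1$, $1\le t\le s^2$, $\lambda\ge0$ and compatible matrices $A_1,\dots,A_t\in M_s(F)$, $A_k=(a^k_{ij})$, put $a_{ij}^k=0$ for $k>t$; let $U$ and $N$ be $F$-vector spaces with bases $u_1,\dots,u_s$ and $w_1,\dots,w_{t+\lambda}$; the ring is the $F$-algebra $F\oplus U\oplus N$ with identity $1\in F$, with $u_iu_j=\sum_k a^k_{ij}w_k$, $u_iw_k=w_ku_i=0$ and $w_kw_l=0$. A ring is said to have invariants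 $p,n,s,t,\lambda$ if it is isomorphic to such a ring with these parameters, where $n=1+s+t+\lambda$ (so its order is $p^n$). *)

(* Defs.v *)
From HB Require Import structures.
From mathcomp Require Import all_boot all_order all_fingroup all_algebra.

Set Implicit Arguments.
Unset Strict Implicit.
Unset Printing Implicit Defensive.

Import GRing.Theory.
Local Open Scope ring_scope.

Section FiniteRings.
Variable R : finNzRingType.
Implicit Types I J : {set R}.

(* Left or right zero-divisors; 0 is included since 1 != 0 in R. *)
Definition zero_divisors : {set R} :=
  [set x | [exists y, (y != 0) && ((x * y == 0) || (y * x == 0))]].

(* Two-sided, whereas idealr_closed only asks for a proper left ideal. *)
Definition two_sided_ideal I : Prop :=
  zmod_closed (mem I) /\ forall a x, x \in I -> a * x \in I /\ x * a \in I.

(* << _ >> is the generated subgroup of the additive group of R: this is the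
   set of finite sums of products x * y. *)
Definition ideal_mul I J : {set R} := <<[set (x * y)%R | x in I, y in J]>>%g.

Definition property_T : Prop :=
  let M := zero_divisors in
  [/\ two_sided_ideal M,
      ideal_mul (ideal_mul M M) M = [set 0]
    & ideal_mul M M <> [set 0]].

(* R / M is isomorphic to F, M being the set of zero-divisors. *)
Definition residue_field_iso (F : finFieldType) : Prop :=
  exists f : {rmorphism R -> F},
    (forall c, exists x, f x = c) /\
    (forall x, (f x == 0) = (x \in zero_divisors)).

Definition commutative_ring : Prop := commutative (@GRing.mul R).

End FiniteRings.

Definition ring_iso (R S : finNzRingType) : Prop :=
  exists f : {rmorphism R -> S}, bijective f.

Definition compatible (F : finFieldType) s t (A : t.-tuple 'M[F]_s) : Prop :=
  free A /\
  forall i : 'I_s, exists (j : 'I_s) (k : 'I_t),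
    (tnth A k i j != 0) || (tnth A k j i != 0).

(* The carrier is F (+) U (+) N with U = 'rV_s and N = 'rV_(t + lam), the bases
   u_i and w_k being the canonical bases of the row spaces. The carrier does not
   depend on A, but A must occur in the type since the product depends on it. *)
Definition constrA (F : finFieldType) (s t lam : nat)
    (A : t.-tuple 'M[F]_s) : Type :=
  (F * 'rV[F]_s * 'rV[F]_(t + lam))%type.
Arguments constrA {F s t} lam A.

Section ConstructionA.
Variables (F : finFieldType) (s t lam : nat) (A : t.-tuple 'M[F]_s).
Local Notation RA := (constrA lam A).

Definition structure_mx (k : 'I_(t + lam)) : 'M[F]_s :=
  if split k is inl k' then tnth A k' else 0.

HB.instance Definition _ := Finite.on RA.
HB.instance Definition _ := GRing.Zmodule.on RA.

Definition U_mul (u v : 'rV[F]_s) : 'rV[F]_(t + lam) :=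
  \row_k \sum_i \sum_j u 0 i * v 0 j * structure_mx k i j.

Definition constrA_one : RA := (1, 0, 0).

Definition constrA_mul (x y : RA) : RA :=
  let: (a, u, w) := x in let: (b, v, z) := y in
  (a * b, a *: v + b *: u, a *: z + b *: w + U_mul u v).

Lemma U_mulDl u1 u2 v : U_mul (u1 + u2) v = U_mul u1 v + U_mul u2 v.
Proof.
apply/rowP=> k; rewrite !mxE -big_split /=; apply: eq_bigr => i _.
by rewrite -big_split /=; apply: eq_bigr => j _; rewrite mxE !mulrDl.
Qed.

Lemma U_mulDr u v1 v2 : U_mul u (v1 + v2) = U_mul u v1 + U_mul u v2.
Proof.
apply/rowP=> k; rewrite !mxE -big_split /=; apply: eq_bigr => i _.
rewrite -big_split /=; apply: eq_bigr => j _.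
by rewrite mxE mulrDr mulrDl.
Qed.

Lemma U_mulZl a u v : U_mul (a *: u) v = a *: U_mul u v.
Proof.
apply/rowP=> k; rewrite !mxE mulr_sumr; apply: eq_bigr => i _.
by rewrite mulr_sumr; apply: eq_bigr => j _; rewrite mxE !mulrA.
Qed.

Lemma U_mulZr a u v : U_mul u (a *: v) = a *: U_mul u v.
Proof.
apply/rowP=> k; rewrite !mxE mulr_sumr; apply: eq_bigr => i _.
rewrite mulr_sumr; apply: eq_bigr => j _.
by rewrite mxE !mulrA (mulrC a).
Qed.

Lemma U_mul0l v : U_mul 0 v = 0.
Proof. by rewrite -(scale0r 0) U_mulZl scale0r. Qed.

Lemma U_mul0r u : U_mul u 0 = 0.
Proof. by rewrite -(scale0r 0) U_mulZr scale0r. Qed.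

Fact constrA_mulA : associative constrA_mul.
Proof.
move=> [[a u] w] [[b v] z] [[c x] y] /=; congr (_, _, _).
- by rewrite mulrA.
- by rewrite !scalerDr !scalerA (mulrC c a) (mulrC c b) addrA.
- rewrite !scalerDr U_mulDl U_mulDr !U_mulZl !U_mulZr !scalerA.
  rewrite (mulrC c a) (mulrC c b) -!addrA; do 2![congr (_ + _)].
  by rewrite addrCA; congr (_ + _); rewrite addrCA [RHS]addrCA addrC -addrA.
Qed.

Fact constrA_mul1l : left_id constrA_one constrA_mul.
Proof.
by move=> [[a u] w]; rewrite /= mul1r !scale1r !scaler0 U_mul0l !addr0.
Qed.

Fact constrA_mul1r : right_id constrA_one constrA_mul.
Proof.
by move=> [[a u] w]; rewrite /= mulr1 !scale1r !scaler0 U_mul0r !add0r addr0.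
Qed.

Fact constrA_mulDl : left_distributive constrA_mul +%R.
Proof.
move=> [[a u] w] [[b v] z] [[c x] y]; congr (_, _, _) => /=.
- exact: mulrDl.
- by rewrite scalerDl scalerDr addrACA.
- by rewrite U_mulDl scalerDl scalerDr
     [X in X + _ = _]addrACA [LHS]addrACA.
Qed.

Fact constrA_mulDr : right_distributive constrA_mul +%R.
Proof.
move=> [[a u] w] [[b v] z] [[c x] y]; congr (_, _, _) => /=.
- exact: mulrDr.
- by rewrite scalerDl scalerDr addrACA.
- by rewrite U_mulDr scalerDl scalerDr
     [X in X + _ = _]addrACA [LHS]addrACA.
Qed.

Fact constrA_one_neq0 : constrA_one != 0.
Proof. by apply/eqP=> -[] /eqP; rewrite oner_eq0. Qed.

HB.instance Definition _ := GRing.Zmodule_isNzRing.Build RA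
  constrA_mulA constrA_mul1l constrA_mul1r constrA_mulDl constrA_mulDr
  constrA_one_neq0.

Definition basis_u (i : 'I_s) : RA := (0, delta_mx 0 i, 0).
Definition basis_w (k : 'I_(t + lam)) : RA := (0, 0, delta_mx 0 k).

Lemma basis_uu i j :
  basis_u i * basis_u j =
  \sum_k ((structure_mx k i j, 0, 0) : RA) * basis_w k.
Proof.
transitivity ((0, 0, \row_k structure_mx k i j) : RA).
  congr (_, _, _); first exact: mulr0.
    by rewrite /= !scale0r addr0.
  rewrite /= !scale0r !add0r; apply/rowP=> k; rewrite !mxE.
  rewrite (bigD1 i) //= (bigD1 j) //= !mxE !eqxx !mul1r.
  rewrite !big1 ?addr0 // => [l /negPf nli | l /negPf nlj].
    by rewrite big1 // => m _; rewrite !mxE nli andbF !mul0r.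
  by rewrite !mxE nlj andbF mulr0 mul0r.
pose inN (w : 'rV[F]_(t + lam)) : RA := (0, 0, w).
have inND : {morph inN : w z / w + z}.
  by move=> w z; congr (_, _, _); rewrite /= addr0.
rewrite [X in (_, X)]row_sum_delta -/(inN _) (big_morph inN inND (erefl _)).
apply: eq_bigr => k _; congr (_, _, _); rewrite /= ?mulr0 ?scaler0 ?addr0 //.
by rewrite U_mul0l addr0 mxE.
Qed.

Lemma basis_uw i k : basis_u i * basis_w k = 0.
Proof.
by congr (_, _, _); rewrite /= ?mulr0 ?scale0r ?U_mul0r ?addr0.
Qed.

Lemma basis_wu i k : basis_w k * basis_u i = 0.
Proof.
by congr (_, _, _); rewrite /= ?mulr0 ?scale0r ?U_mul0l ?addr0.
Qed.

Lemma basis_ww k l : basis_w k * basis_w l = 0.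
Proof.
by congr (_, _, _); rewrite /= ?mulr0 ?scale0r ?U_mul0r ?addr0.
Qed.

End ConstructionA.

(* The prime p enters through F = 'F_p, which is the field of order p only when
   p is prime. *)
Definition has_invariants (p n s t lam : nat) (R : finNzRingType) : Prop :=
  [/\ (1 <= s)%N, (1 <= t <= s ^ 2)%N, n = (1 + s + t + lam)%N
    & exists A : t.-tuple 'M['F_p]_s,
        compatible A /\ ring_iso R (constrA lam A)].

Definition ring_class (p n s t lam : nat) (R : finNzRingType) : Prop :=
  [/\ property_T R, p \in [pchar R], residue_field_iso R 'F_p
    & has_invariants p n s t lam R].

(* There are exactly k isomorphism classes of finite rings satisfying P. *)
Definition num_iso_classes (P : finNzRingType -> Prop) (k : nat) : Prop :=
  exists X : 'I_k -> finNzRingType,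
    [/\ forall i, P (X i),
        forall i j, ring_iso (X i) (X j) -> i = j
      & forall R, P R -> exists i, ring_iso R (X i)].

(* Main.v *)
(** The annihilator of the radical is N, so an isomorphism between two rings of
   Construction A amounts to a linear automorphism C of U and a linear
   automorphism of the span of the products. The rings are thus classified by
   the 2-dimensional spaces W of bilinear forms on F_p^2 up to congruence, and
   the commutative ones are those where W consists of symmetric forms.

   Let p be odd. If W is symmetric, the determinant is a binary quadratic form
   on W that is degenerate, split or anisotropic, and these are the three
   commutative classes. Otherwise the symmetric forms in W
   span a line <S>, where S is x^2, xy or x^2 - eps y^2 up to congruence and
   scalars (eps a nonsquare), and W = <S, T> with T - T^t a fixed alternating
   form. The group of similitudes of S acts on the possible symmetric parts of T
   modulo S:
   - S = x^2: the orbits are those of multiples of xy, on which the action is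
     trivial (p classes), and all the others (1 class);
   - S = xy: T = a x^2 + d y^2 is classified by the product ad, except that
     ad = 0 gives two orbits (p + 1 classes);
   - S = x^2 - eps y^2: Sym / S is F_(p^2) on which l acts by multiplication
     by l / conj l, so by Hilbert 90 the norm classifies the orbits (p classes).
   For p = 2 there are only finitely many spaces, which are enumerated. *)
Require Import Defs.
From HB Require Import structures.
From mathcomp Require Import all_boot all_order all_fingroup all_algebra.
From mathcomp Require Import all_solvable ring zify.

Set Implicit Arguments.
Unset Strict Implicit.
Unset Printing Implicit Defensive.

Import GRing.Theory.
Local Open Scope ring_scope.

(** * Isomorphisms between rings of Construction A *)

Lemma ring_iso_trans (R S T : finNzRingType) :
  ring_iso R S -> ring_iso S T -> ring_iso R T.
Proof.
move=> [f bij_f] [g bij_g].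
exists (g \o f : {rmorphism R -> T}); exact: bij_comp.
Qed.

Lemma ring_iso_commutative (R S : finNzRingType) :
  ring_iso R S -> commutative_ring R <-> commutative_ring S.
Proof.
move=> [f [g fK gK]]; split=> comR x y.
  by rewrite -(gK x) -(gK y) -!rmorphM comR.
by apply: (can_inj fK); rewrite !rmorphM comR.
Qed.

(** In a finite additive group, a set containing 0 and closed under sums is a subgroup, and
    [ideal_mul] is the least subgroup containing the products. *)
Lemma ideal_mul_subset (R : finNzRingType) (I J N : {set R}) :
  0 \in N -> {in N &, forall x y, x + y \in N} ->
  {in I & J, forall x y, x * y \in N} -> ideal_mul I J \subset N.
Proof.
move=> N0 ND NM; have gN : group_set N by apply/group_setP.
rewrite -[N]/(gval (group gN)) gen_subG.
by apply/subsetP=> _ /imset2P[x y xI yJ ->]; apply: NM.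
Qed.

Lemma ideal_mul_eq0 (R : finNzRingType) (I J : {set R}) :
  ideal_mul I J = [set 0] <-> {in I & J, forall x y, x * y = 0}.
Proof.
split=> [IJ0 x y xI yJ | IJ0].
  by apply/set1P; rewrite -IJ0; apply: mem_gen; apply: imset2_f.
apply/eqP; rewrite eqEsubset sub1set (group1 <<_>>) andbT.
apply: ideal_mul_subset; first exact: set11.
  by move=> x y /set1P-> /set1P->; rewrite addr0 set11.
by move=> x y xI yJ; rewrite IJ0 ?set11.
Qed.

Section ConstructionA.
Variables (F : finFieldType) (s t lam : nat).
Implicit Types (A B : t.-tuple 'M[F]_s) (u v : 'rV[F]_s).

(** Basis-free form of the second clause of [compatible]: no nonzero vector of U, rather than no
    basis vector, annihilates U on both sides. The annihilator of the radical is then exactly N. *)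
Definition zero_annihilator A :=
  forall u, (forall k, u *m tnth A k = 0 /\ u *m (tnth A k)^T = 0) -> u = 0.

(** On row vectors, [C] is the map induced on U and [G] the map induced on the span of the products,
    both going from the ring of [A] to the ring of [B]. *)
Definition congruent A B :=
  exists (C : 'M[F]_s) (G : 'M[F]_t),
    [/\ C \in unitmx, G \in unitmx
      & forall k, C *m tnth B k *m C^T = \sum_l G l k *: tnth A l].

Lemma structure_mx_lshift A k : structure_mx A (lshift lam k) = tnth A k.
Proof. by rewrite /structure_mx (unsplitK (inl k)). Qed.

Lemma structure_mx_rshift A (k : 'I_lam) : structure_mx A (rshift t k) = 0 :> 'M[F]_s.
Proof. by rewrite /structure_mx (unsplitK (inr k)). Qed.

Lemma U_mulE A u v k :
  U_mul lam A u v 0 k = (u *m structure_mx A k *m v^T) 0 0.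
Proof.
rewrite !mxE exchange_big /=; apply: eq_bigr => j _.
rewrite !mxE mulr_suml; apply: eq_bigr => i _.
by rewrite mulrAC.
Qed.

Lemma U_mul_eq0l A u :
  (forall v, U_mul lam A u v = 0) -> forall k, u *m tnth A k = 0.
Proof.
move=> uv0 k; apply/rowP=> j; rewrite [RHS]mxE.
have /rowP/(_ (lshift lam k)) := uv0 (delta_mx 0 j).
by rewrite U_mulE structure_mx_lshift trmx_delta -colE !mxE.
Qed.

Lemma U_mul_eq0r A u :
  (forall v, U_mul lam A v u = 0) -> forall k, u *m (tnth A k)^T = 0.
Proof.
move=> uv0 k; apply: trmx_inj; rewrite trmx_mul trmxK trmx0.
apply/colP=> j; rewrite [RHS]mxE.
have /rowP/(_ (lshift lam k)) := uv0 (delta_mx 0 j).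
by rewrite U_mulE structure_mx_lshift -rowE -row_mul !mxE.
Qed.

Lemma U_mul_zero_annihilator A u : zero_annihilator A ->
  (forall v, U_mul lam A u v = 0 /\ U_mul lam A v u = 0) -> u = 0.
Proof.
move=> ndA uv0; apply: ndA => k.
by split; [apply: (@U_mul_eq0l A) | apply: (@U_mul_eq0r A)] => v; case: (uv0 v).
Qed.

Local Notation R A := (constrA lam A).

Lemma constrA_mulE A (x y : R A) :
  x * y = (x.1.1 * y.1.1, x.1.1 *: y.1.2 + y.1.1 *: x.1.2,
           x.1.1 *: y.2 + y.1.1 *: x.2 + U_mul lam A x.1.2 y.1.2).
Proof. by case: x y => [[a u] w] [[b v] z]. Qed.

(** Describes the radical by an equation that every ring isomorphism preserves. *)
Lemma constrA_nil3 A (x : R A) : (x ^+ 3 == 0) = (x.1.1 == 0).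
Proof.
case: x => [[a u] w] /=; apply/eqP/eqP=> [|->].
  move/(congr1 (fun y : R A => y.1.1)) => /= aaa.
  by apply/eqP; rewrite -[_ == 0](@expf_eq0 F a 3); apply/eqP.
rewrite exprS expr2 !constrA_mulE /= !mul0r !scale0r !add0r.
by rewrite U_mul0r.
Qed.

Lemma congruent_ring_iso A B : congruent A B -> ring_iso (R A) (R B).
Proof.
move=> [C [G [uC uG CG]]].
(* [G] acts on the first [t] basis vectors of N and the [lam] others stay fixed. *)
pose D : 'M_(t + lam) := block_mx G 0 0 1%:M.
have uD : D \in unitmx by rewrite unitmxE det_ublock det1 mulr1 -unitmxE.
pose f (x : R A) : R B := (x.1.1, x.1.2 *m C, x.2 *m D).
have CD k : C *m structure_mx B k *m C^T = \sum_l D l k *: structure_mx A l.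
  rewrite big_split_ord /= [X in _ + X]big1 ?addr0; last first.
    by move=> l _; rewrite structure_mx_rshift scaler0.
  case: (split_ordP k) => {}k ->.
    rewrite structure_mx_lshift CG; apply: eq_bigr => l _.
    by rewrite structure_mx_lshift block_mxEul.
  rewrite structure_mx_rshift mulmx0 mul0mx big1 // => l _.
  by rewrite block_mxEur mxE scale0r.
have fU u v : U_mul lam B (u *m C) (v *m C) = U_mul lam A u v *m D.
  apply/rowP=> k; rewrite U_mulE trmx_mul.
  rewrite !mulmxA -(mulmxA u) -(mulmxA u) CD mulmx_sumr mulmx_suml.
  rewrite summxE mxE; apply: eq_bigr => l _.
  by rewrite U_mulE -scalemxAr -scalemxAl mxE mulrC.
have fB : zmod_morphism f.
  by move=> [[a u] w] [[b v] z]; congr (_, _, _); rewrite /= mulmxBl.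
have fM : monoid_morphism f.
  split; first by congr (_, _, _); rewrite /= mul0mx.
  move=> x y; rewrite !constrA_mulE /f /=; congr (_, _, _).
    by rewrite mulmxDl !scalemxAl.
  by rewrite fU !mulmxDl !scalemxAl.
pose fA := GRing.isZmodMorphism.Build _ _ f fB.
pose fR := GRing.isMonoidMorphism.Build _ _ f fM.
pose g : {rmorphism R A -> R B} := HB.pack f fA fR.
exists g; exists (fun y : R B => (y.1.1, y.1.2 *m invmx C, y.2 *m invmx D) : R A).
  by move=> [[a u] w]; congr (_, _, _); rewrite /= mulmxK.
by move=> [[a u] w]; congr (_, _, _); rewrite /= mulmxKV.
Qed.

Lemma constrA_commutative A :
  commutative_ring (R A) <-> forall k, (tnth A k)^T = tnth A k.
Proof.
split=> [comA k | symA [[a u] w] [[b v] z]].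
  apply/matrixP=> i j; rewrite mxE.
  have := comA (0, delta_mx 0 j, 0) (0, delta_mx 0 i, 0).
  rewrite !constrA_mulE /= => -[_] /rowP/(_ (lshift lam k)).
  rewrite !scaler0 !add0r !U_mulE structure_mx_lshift !trmx_delta -!colE -!rowE.
  by rewrite !mxE.
rewrite !constrA_mulE /=; congr (_, _, _).
- exact: mulrC.
- by rewrite addrC.
rewrite [b *: w + _]addrC; congr (_ + _); apply/rowP=> k.
rewrite !U_mulE.
(* A 1 x 1 matrix equals its transpose, and transposing u A v^T exchanges u and v. *)
have -> (M : 'M[F]_1) : M 0 0 = M^T 0 0 by rewrite mxE.
rewrite !trmx_mul trmxK mulmxA.
case: (split_ordP k) => {}k ->.
  by rewrite structure_mx_lshift symA.
by rewrite structure_mx_rshift trmx0.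
Qed.

Lemma constrA_zero_divisors A (x : R A) : (0 < t)%N ->
  (x \in zero_divisors (constrA lam A)) = (x.1.1 == 0).
Proof.
move=> t0; case: x => [[a u] w] /=; rewrite inE; apply/existsP/eqP.
  move=> [[[b v] z]] /andP[/eqP y0 /orP xy0]; apply/eqP; apply: contraT => a0.
  case: y0; case: xy0 => /eqP; rewrite constrA_mulE /= => -[] /eqP.
    rewrite mulf_eq0 (negPf a0) /= => /eqP ->; rewrite scale0r addr0 => /eqP.
    rewrite scaler_eq0 (negPf a0) /= => /eqP ->.
    rewrite U_mul0r scale0r !addr0 => /eqP.
    by rewrite scaler_eq0 (negPf a0) /= => /eqP ->.
  rewrite mulf_eq0 (negPf a0) orbF => /eqP ->; rewrite scale0r add0r => /eqP.
  rewrite scaler_eq0 (negPf a0) /= => /eqP ->.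
  rewrite U_mul0l scale0r addr0 add0r => /eqP.
  by rewrite scaler_eq0 (negPf a0) /= => /eqP ->.
(* The first basis vector of N, which exists since [0 < t], is killed by the whole radical. *)
move=> ->; exists (0, 0, delta_mx 0 (lshift lam (Ordinal t0))).
apply/andP; split; last first.
  by rewrite constrA_mulE /= mul0r !scale0r U_mul0r !addr0 eqxx.
apply/eqP=> -[] /rowP/(_ (lshift lam (Ordinal t0))); rewrite !mxE !eqxx /=.
by apply/eqP; rewrite oner_eq0.
Qed.

Lemma constrA_property_T A : (0 < s)%N -> (0 < t)%N -> compatible A ->
  property_T (constrA lam A).
Proof.
move=> s0 t0 [_ cA].
have ME x := constrA_zero_divisors (A := A) x t0.
pose N := [set x : R A | x.1 == 0].
have MMN : ideal_mul (zero_divisors (R A)) (zero_divisors (R A)) \subset N.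
  apply: ideal_mul_subset; first by rewrite inE.
    by move=> x y; rewrite !inE /= => /eqP-> /eqP->; rewrite addr0.
  move=> x y; rewrite !ME inE => /eqP x0 /eqP y0.
  by rewrite constrA_mulE x0 y0 /= mul0r !scale0r addr0.
split.
- split.
    have M0 : 0 \in zero_divisors (R A) by rewrite ME.
    have MB x y : x \in zero_divisors (R A) -> y \in zero_divisors (R A) ->
        x - y \in zero_divisors (R A).
      by rewrite !ME => /eqP x0 /eqP y0; rewrite /= x0 y0 subr0.
    by split=> [|x y]; [apply: M0 | apply: MB].
  move=> a x; rewrite !ME !constrA_mulE /= => /eqP->.
  by rewrite mulr0 mul0r.
- apply/ideal_mul_eq0 => x y /(subsetP MMN); rewrite ME inE => /eqP x0 /eqP y0.
  by rewrite constrA_mulE x0 y0 /= mul0r !scale0r U_mul0l !addr0.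
move=> /ideal_mul_eq0 MM0.
have prod0 i j : U_mul lam A (delta_mx 0 i) (delta_mx 0 j) = 0.
  have := MM0 (0, delta_mx 0 i, 0) (0, delta_mx 0 j, 0).
  rewrite !ME /= => /(_ (eqxx _) (eqxx _)); rewrite constrA_mulE /= => -[_].
  by rewrite !scaler0 !add0r.
have A0 i j k : tnth A k i j = 0.
  have /rowP/(_ (lshift lam k)) := prod0 i j.
  by rewrite U_mulE structure_mx_lshift trmx_delta -colE -rowE !mxE.
by have [j [k]] := cA (Ordinal s0); rewrite !A0 eqxx.
Qed.

Lemma constrA_residue_field A : (0 < t)%N ->
  residue_field_iso (constrA lam A) F.
Proof.
move=> t0; pose f (x : R A) : F := x.1.1.
have fB : zmod_morphism f by [].
have fM : monoid_morphism f.
  by split=> // x y; rewrite constrA_mulE.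
pose fA := GRing.isZmodMorphism.Build _ _ f fB.
pose fR := GRing.isMonoidMorphism.Build _ _ f fM.
pose g : {rmorphism R A -> F} := HB.pack f fA fR.
exists g; split=> [c | x]; first by exists ((c, 0, 0) : R A).
by rewrite constrA_zero_divisors.
Qed.

Lemma constrA_natmul A n : (n%:R : R A) = (n%:R, 0, 0).
Proof.
elim: n => // n IHn; rewrite !mulrS IHn; congr (_, _, _); exact: addr0.
Qed.

End ConstructionA.

(** * From ring isomorphisms to congruences over a prime field *)

Section PrimeField.
Variables (p s t lam : nat).
Implicit Types (A B : t.-tuple 'M['F_p]_s).

Lemma F_pE (c : 'F_p) : c = (nat_of_ord c)%:R.
Proof. by rewrite natr_Zp. Qed.

(** Scalars of ['F_p] are natural multiples of 1, so additivity gives linearity and no field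
    automorphism enters. *)
Lemma additive_F_p_scale (V W : lmodType 'F_p) (f : {additive V -> W}) c v :
  f (c *: v) = c *: f v.
Proof. by rewrite (F_pE c) !scaler_nat raddfMn. Qed.

(** An isomorphism preserves the radical and its annihilator N. It thus induces linear maps on U,
    seen as the radical modulo N, and on N; their matrices [C] and [D] satisfy the congruence
    relation. *)
Lemma ring_iso_congruent A B : free B ->
  zero_annihilator A -> zero_annihilator B ->
  ring_iso (constrA lam A) (constrA lam B) -> congruent A B.
Proof.
move=> freeB ndA ndB [f [g fK gK]].
have f11 x : ((f x).1.1 == 0) = (x.1.1 == 0).
  by rewrite -!constrA_nil3 -rmorphXn raddf_eq0 //; apply: can_inj fK.
pose fU (u : 'rV['F_p]_s) := (f (0, u, 0)).1.2.
pose fN (w : 'rV['F_p]_(t + lam)) := (f (0, 0, w)).2.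
have fB12 x y : (f (x - y)).1.2 = (f x).1.2 - (f y).1.2 by rewrite rmorphB.
have fB2 x y : (f (x - y)).2 = (f x).2 - (f y).2 by rewrite rmorphB.
have fUB : zmod_morphism fU.
  move=> u v; rewrite /fU -fB12.
  by congr (f _).1.2; congr (_, _, _); rewrite /= subr0.
have fNB : zmod_morphism fN.
  move=> u v; rewrite /fN -fB2.
  by congr (f _).2; congr (_, _, _); rewrite /= subr0.
pose fUa := GRing.isZmodMorphism.Build _ _ fU fUB.
pose fUA : {additive 'rV['F_p]_s -> 'rV['F_p]_s} := HB.pack fU fUa.
pose fNa := GRing.isZmodMorphism.Build _ _ fN fNB.
pose fNA : {additive 'rV['F_p]_(t + lam) -> 'rV['F_p]_(t + lam)} := HB.pack fN fNa.
pose C := \matrix_i fU (delta_mx 0 i).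
pose D := \matrix_i fN (delta_mx 0 i).
have fUE u : fU u = u *m C.
  rewrite [u in LHS]row_sum_delta mulmx_sum_row -[fU]/(fUA : _ -> _) raddf_sum.
  by apply: eq_bigr => i _; rewrite additive_F_p_scale rowK.
have fNE w : fN w = w *m D.
  rewrite [w in LHS]row_sum_delta mulmx_sum_row -[fN]/(fNA : _ -> _) raddf_sum.
  by apply: eq_bigr => i _; rewrite additive_F_p_scale rowK.
(* An element of N annihilates the radical, hence so does its image. Every [v] is reached because
   [f] is onto, so the U-component of the image vanishes. *)
have fN12 w : (f (0, 0, w)).1.2 = 0.
  apply: (U_mul_zero_annihilator (lam := lam) ndB) => v.
  have := gK (0, v, 0); set y := g _ => fy.
  have y0 : y.1.1 = 0 by apply/eqP; rewrite -f11 fy.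
  have x0 : (f (0, 0, w)).1.1 = 0 by apply/eqP; rewrite f11.
  have xy : ((0, 0, w) : constrA lam A) * y = 0.
    by rewrite constrA_mulE y0 /= mul0r !scale0r U_mul0l !addr0.
  have yx : y * ((0, 0, w) : constrA lam A) = 0.
    by rewrite constrA_mulE y0 /= mul0r !scale0r U_mul0r !addr0.
  have := congr1 f xy; have := congr1 f yx; rewrite !rmorphM rmorph0 fy.
  rewrite !constrA_mulE x0 !scale0r !add0r.
  by move=> /(congr1 snd) /= vw /(congr1 snd) /= wv.
have fUN u v : U_mul lam B (u *m C) (v *m C) = U_mul lam A u v *m D.
  rewrite -!fUE -fNE.
  have uvE : ((0, u, 0) : constrA lam A) * ((0, v, 0) : constrA lam A)
             = (0, 0, U_mul lam A u v).
    by rewrite constrA_mulE /= mul0r !scale0r !add0r.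
  have u0 : (f (0, u, 0)).1.1 = 0 by apply/eqP; rewrite f11.
  have v0 : (f (0, v, 0)).1.1 = 0 by apply/eqP; rewrite f11.
  have := congr1 f uvE; rewrite rmorphM constrA_mulE u0 v0 !scale0r !add0r.
  by move/(congr1 snd) => /= ->.
(* If [u *m C = 0], the image of [u] lies in N and annihilates the radical; by injectivity [u]
   annihilates it too. *)
have uC : C \in unitmx.
  rewrite -row_free_unit -kermx_eq0; apply/rowV0P=> u /sub_kermxP uC0.
  apply: (U_mul_zero_annihilator (lam := lam) ndA) => v.
  have fu0 : (f (0, u, 0)).1 = 0.
    rewrite [LHS]surjective_pairing -/(fU u) fUE uC0.
    by congr (_, _); apply/eqP; rewrite f11.
  pose y : constrA lam A := (0, v, 0).
  have /eqP y0 : (f y).1.1 == 0 by rewrite f11.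
  have uv0 : ((0, u, 0) : constrA lam A) * y = 0.
    apply: (can_inj fK); rewrite rmorphM rmorph0 constrA_mulE fu0 y0 /=.
    by rewrite !scale0r U_mul0l mul0r !addr0.
  have vu0 : y * ((0, u, 0) : constrA lam A) = 0.
    apply: (can_inj fK); rewrite rmorphM rmorph0 constrA_mulE fu0 y0 /=.
    by rewrite !scale0r U_mul0r mul0r !addr0.
  move: uv0 vu0; rewrite !constrA_mulE /= !scale0r !add0r.
  by move=> /(congr1 snd) /= uv0 /(congr1 snd) /= vu0.
(* The structure matrices of index at least [t] vanish, so only the upper left block of [D]
   enters. *)
have CD (k : 'I_t) :
    C *m tnth B k *m C^T = \sum_l ulsubmx D l k *: tnth A l.
  apply/matrixP=> i j.
  have /rowP/(_ (lshift lam k)) := fUN (delta_mx 0 i) (delta_mx 0 j).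
  rewrite U_mulE structure_mx_lshift trmx_mul trmx_delta !mulmxA -colE.
  rewrite -!mulmxA -rowE !mulmxA !mxE => ->.
  rewrite summxE big_split_ord /= [X in _ + X]big1 ?addr0; last first.
    by move=> l _; rewrite U_mulE structure_mx_rshift mulmx0 mul0mx mxE mul0r.
  apply: eq_bigr => l _.
  rewrite U_mulE structure_mx_lshift trmx_delta -colE -rowE !mxE.
  by rewrite mulrC.
move: (ulsubmx D) CD => G CD; exists C, G; split=> //.
(* A vector [c] killed by [G^T] would be a linear relation between the matrices of [B], which are
   free. *)
rewrite -unitmx_tr -row_free_unit -kermx_eq0; apply/rowV0P=> c /sub_kermxP cG0.
have sum0 : \sum_k c 0 k *: B`_k = 0.
  apply: (can_inj (mulKmx uC)); apply: (can_inj (mulmxK (_ : C^T \in unitmx))).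
    by rewrite unitmx_tr.
  rewrite mulmx0 mul0mx mulmx_sumr mulmx_suml.
  under eq_bigr => k _.
    rewrite -scalemxAr -scalemxAl -(tnth_nth 0) CD scaler_sumr; over.
  rewrite exchange_big big1 // => l _.
  under eq_bigr do rewrite scalerA.
  rewrite -scaler_suml.
  have /rowP/(_ l) := cG0; rewrite !mxE.
  by under eq_bigr do rewrite mxE; move=> ->; rewrite scale0r.
by apply/rowP=> k; rewrite mxE; move/freeP: freeB; apply.
Qed.

End PrimeField.

(** * Congruence of pairs of 2 x 2 matrices *)

Section Matrices2.
Variable F : fieldType.
Implicit Types (a b c d x y : F) (M : 'M[F]_2) (A B : 'M[F]_2 * 'M[F]_2).

Definition mx2 a b c d : 'M[F]_2 :=
  \matrix_(i, j) if i == 0 then (if j == 0 then a else b)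
                 else (if j == 0 then c else d).

Lemma mx2E M : M = mx2 (M 0 0) (M 0 1) (M 1 0) (M 1 1).
Proof.
apply/matrixP=> i j; rewrite mxE.
by case: i j => [[|[|i]] // hi] [[|[|j]] // hj] /=; congr (M _ _); apply: val_inj.
Qed.

Lemma mx2_inj a b c d a' b' c' d' : mx2 a b c d = mx2 a' b' c' d' ->
  [/\ a = a', b = b', c = c' & d = d'].
Proof.
move/matrixP=> e; have := (e 0 0, e 0 1, e 1 0, e 1 1).
by rewrite !mxE /= => -[[[-> ->] ->] ->].
Qed.

Lemma mx2D a b c d a' b' c' d' :
  mx2 a b c d + mx2 a' b' c' d' = mx2 (a + a') (b + b') (c + c') (d + d').
Proof. by rewrite [LHS]mx2E !mxE. Qed.

Lemma mx2Z x a b c d : x *: mx2 a b c d = mx2 (x * a) (x * b) (x * c) (x * d).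
Proof. by rewrite [LHS]mx2E !mxE. Qed.

Lemma mx2T a b c d : (mx2 a b c d)^T = mx2 a c b d.
Proof. by rewrite [LHS]mx2E !mxE. Qed.

Lemma mx2M a b c d a' b' c' d' :
  mx2 a b c d *m mx2 a' b' c' d' =
  mx2 (a * a' + b * c') (a * b' + b * d') (c * a' + d * c') (c * b' + d * d').
Proof. by rewrite [LHS]mx2E !mxE !big_ord_recl !big_ord0 !mxE /= !addr0. Qed.

Lemma mx2_0 : 0 = mx2 0 0 0 0.
Proof. by rewrite [LHS]mx2E !mxE. Qed.

Lemma det_mx2 a b c d : \det (mx2 a b c d) = a * d - b * c.
Proof.
rewrite (expand_det_row _ 0) !big_ord_recl big_ord0 /cofactor !det_mx11 !mxE /=.
by rewrite expr0 expr1 mul1r mulN1r mulrN addr0.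
Qed.

Definition mx2_simp := (mx2D, mx2Z, mx2T, mx2M, det_mx2).

(** [C] changes the basis of U and [G] the basis of the span. Compared with [congruent], the two
    sides are exchanged and [G] is transposed. *)
Definition pair_congruent A B :=
  exists C G : 'M[F]_2, [/\ C \in unitmx, G \in unitmx,
    C *m A.1 *m C^T = G 0 0 *: B.1 + G 0 1 *: B.2
  & C *m A.2 *m C^T = G 1 0 *: B.1 + G 1 1 *: B.2].

Definition independent A :=
  forall x y, x *: A.1 + y *: A.2 = 0 -> x = 0 /\ y = 0.

Definition symmetric_pair A := A.1^T = A.1 /\ A.2^T = A.2.

Lemma pair_congruent_trans A B D :
  pair_congruent A B -> pair_congruent B D -> pair_congruent A D.
Proof.
move=> [C [G [uC uG A1 A2]]] [C' [G' [uC' uG' B1 B2]]].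
exists (C' *m C), (G *m G').
have E M : (C' *m C) *m M *m (C' *m C)^T = C' *m (C *m M *m C^T) *m C'^T.
  by rewrite trmx_mul !mulmxA.
split; rewrite ?unitmx_mul ?uC ?uC' ?uG ?uG' //.
  rewrite E A1 mulmxDr mulmxDl -!scalemxAr -!scalemxAl B1 B2 !mxE.
  rewrite !big_ord_recl !big_ord0 (_ : lift 0 0 = 1); last exact: val_inj.
  by apply/matrixP=> i j; rewrite !mxE; ring.
rewrite E A2 mulmxDr mulmxDl -!scalemxAr -!scalemxAl B1 B2 !mxE.
rewrite !big_ord_recl !big_ord0 (_ : lift 0 0 = 1); last exact: val_inj.
by apply/matrixP=> i j; rewrite !mxE; ring.
Qed.

Lemma pair_congruent_sym A B : pair_congruent A B -> pair_congruent B A.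
Proof.
move=> [C [G [uC uG A1 A2]]]; exists (invmx C), (invmx G).
rewrite !unitmx_inv uC uG; split=> //.
  have -> : B.1 = invmx G 0 0 *: (C *m A.1 *m C^T)
                + invmx G 0 1 *: (C *m A.2 *m C^T).
    rewrite A1 A2; have /matrixP e := mulVmx uG.
    have := (e 0 0, e 0 1); rewrite !mxE !big_ord_recl !big_ord0 !addr0.
    rewrite (_ : lift 0 0 = 1); last exact: val_inj.
    move=> /= [e1 e2]; rewrite !scalerDr !scalerA addrACA -!scalerDl e1 e2.
    by rewrite scale1r scale0r addr0.
  rewrite mulmxDr mulmxDl -!scalemxAr -!scalemxAl trmx_inv !mulmxA.
  by rewrite mulVmx // !mul1mx !mulmxK // unitmx_tr.
have -> : B.2 = invmx G 1 0 *: (C *m A.1 *m C^T)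
              + invmx G 1 1 *: (C *m A.2 *m C^T).
  rewrite A1 A2; have /matrixP e := mulVmx uG.
  have := (e 1 0, e 1 1); rewrite !mxE !big_ord_recl !big_ord0 !addr0.
  rewrite (_ : lift 0 0 = 1); last exact: val_inj.
  move=> /= [e1 e2]; rewrite !scalerDr !scalerA addrACA -!scalerDl e1 e2.
  by rewrite scale1r scale0r add0r.
rewrite mulmxDr mulmxDl -!scalemxAr -!scalemxAl trmx_inv !mulmxA.
by rewrite mulVmx // !mul1mx !mulmxK // unitmx_tr.
Qed.

Lemma pair_congruent_base a b c d A : a * d - b * c != 0 ->
  pair_congruent A (a *: A.1 + b *: A.2, c *: A.1 + d *: A.2).
Proof.
move=> D0; apply: pair_congruent_sym; exists 1%:M, (mx2 a b c d).
rewrite unitmx1 unitmxE det_mx2 unitfE D0 !mxE /=.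
by split; rewrite ?mul1mx ?trmx1 ?mulmx1.
Qed.

(* The discriminant of the quadratic form (x, y) |-> \det (x A.1 + y A.2). *)
Definition disc A :=
  (A.1 0 0 * A.2 1 1 + A.2 0 0 * A.1 1 1
   - A.1 0 1 * A.2 1 0 - A.2 0 1 * A.1 1 0) ^+ 2 - 4 * \det A.1 * \det A.2.

Definition skew_coef M := M 0 1 - M 1 0.
(* Zero if the span of A is symmetric; otherwise it generates the line of
   symmetric matrices of the span. *)
Definition symmetric_part A := skew_coef A.2 *: A.1 - skew_coef A.1 *: A.2.

Lemma mx2_ind (P : 'M[F]_2 -> Prop) :
  (forall a b c d, P (mx2 a b c d)) -> forall M, P M.
Proof. by move=> PM M; rewrite [M]mx2E. Qed.

Lemma mx2_entries a b c d :
  (mx2 a b c d 0 0 = a) * (mx2 a b c d 0 1 = b)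
  * (mx2 a b c d 1 0 = c) * (mx2 a b c d 1 1 = d).
Proof. by rewrite !mxE. Qed.

(** Congruence by [C] multiplies the skew coefficient by [\det C]. *)
Lemma symmetric_part_act C A :
  symmetric_part (C *m A.1 *m C^T, C *m A.2 *m C^T) =
  \det C *: (C *m symmetric_part A *m C^T).
Proof.
case: A => A1 A2; rewrite /symmetric_part /skew_coef /=.
elim/mx2_ind: C => p q r s; elim/mx2_ind: A1 => a1 b1 c1 d1.
elim/mx2_ind: A2 => a2 b2 c2 d2; rewrite -!scaleNr !(mx2_simp, mx2_entries).
congr mx2; ring.
Qed.

(** [symmetric_part] is bilinear and alternating in the two members of the pair. *)
Lemma symmetric_part_base (G : 'M[F]_2) A :
  symmetric_part (G 0 0 *: A.1 + G 0 1 *: A.2, G 1 0 *: A.1 + G 1 1 *: A.2) =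
  \det G *: symmetric_part A.
Proof.
case: A => A1 A2; rewrite /symmetric_part /skew_coef /=.
elim/mx2_ind: G => p q r s; elim/mx2_ind: A1 => a1 b1 c1 d1.
elim/mx2_ind: A2 => a2 b2 c2 d2; rewrite -!scaleNr !(mx2_simp, mx2_entries).
congr mx2; ring.
Qed.

(** All determinants on the span are multiplied by [\det C ^+ 2], and a discriminant is quadratic in
    the coefficients of its form. *)
Lemma disc_act C A :
  disc (C *m A.1 *m C^T, C *m A.2 *m C^T) = \det C ^+ 4 * disc A.
Proof.
case: A => A1 A2; rewrite /disc /=.
elim/mx2_ind: C => p q r s; elim/mx2_ind: A1 => a1 b1 c1 d1.
elim/mx2_ind: A2 => a2 b2 c2 d2; rewrite !(mx2_simp, mx2_entries).
ring.
Qed.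

Lemma disc_base (G : 'M[F]_2) A :
  disc (G 0 0 *: A.1 + G 0 1 *: A.2, G 1 0 *: A.1 + G 1 1 *: A.2) =
  \det G ^+ 2 * disc A.
Proof.
case: A => A1 A2; rewrite /disc /=.
elim/mx2_ind: G => p q r s; elim/mx2_ind: A1 => a1 b1 c1 d1.
elim/mx2_ind: A2 => a2 b2 c2 d2; rewrite !(mx2_simp, mx2_entries).
ring.
Qed.

(** Both quantities scale by the same square, so their square classes and their ratio are
    invariants. *)
Lemma pair_congruent_covariants A B : pair_congruent A B ->
  [/\ symmetric_part B = 0 -> symmetric_part A = 0,
      symmetric_part A = 0 -> symmetric_part B = 0
    & exists2 r, r != 0 & \det (symmetric_part B) = r ^+ 2 * \det (symmetric_part A)
                       /\ disc B = r ^+ 2 * disc A].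
Proof.
move=> [C [G [uC uG A1 A2]]].
have := symmetric_part_act C A; rewrite A1 A2 symmetric_part_base => eS.
have := disc_act C A; rewrite A1 A2 disc_base => eD.
have C0 : \det C != 0 by rewrite -unitfE -unitmxE.
have G0 : \det G != 0 by rewrite -unitfE -unitmxE.
split.
- move=> B0; move/eqP: eS; rewrite B0 scaler0 eq_sym scaler_eq0 (negPf C0) /=.
  move=> /eqP /(canRL (mulmxK (_ : C^T \in unitmx))); rewrite unitmx_tr uC.
  by move=> /(_ isT); rewrite mul0mx => /(canRL (mulKmx uC)); rewrite mulmx0.
- move=> A0; move/eqP: eS; rewrite A0 mulmx0 mul0mx scaler0 scaler_eq0.
  by rewrite (negPf G0) => /eqP.
exists (\det C ^+ 2 / \det G); first by rewrite mulf_neq0 ?invr_eq0 ?expf_neq0.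
split.
  move/(congr1 determinant): eS; rewrite !detZ !det_mulmx det_tr => eS.
  by apply: (mulfI (expf_neq0 2 G0)); rewrite eS; field.
by apply: (mulfI (expf_neq0 2 G0)); rewrite eD; field.
Qed.

(* The alternating matrix is unique up to a scalar, so its membership in the
   span is preserved by congruences. *)
Definition has_alternating A :=
  exists x y, x *: A.1 + y *: A.2 = mx2 0 1 (-1) 0.

Lemma has_alternating_congruent A B :
  pair_congruent A B -> has_alternating A -> has_alternating B.
Proof.
move=> [C [G [uC uG A1 A2]]] [x [y xyJ]].
have C0 : \det C != 0 by rewrite -unitfE -unitmxE.
exists ((x * G 0 0 + y * G 1 0) / \det C), ((x * G 0 1 + y * G 1 1) / \det C).
apply: (scalerI C0); rewrite scalerDr !scalerA ![\det C * _]mulrC !divfK //.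
transitivity (C *m (x *: A.1 + y *: A.2) *m C^T).
  rewrite mulmxDr mulmxDl -!scalemxAr -!scalemxAl A1 A2.
  by apply/matrixP=> i j; rewrite !mxE; ring.
rewrite xyJ; elim/mx2_ind: C {C0 uC A1 A2} => p q r s.
by rewrite !mx2_simp; congr mx2; ring.
Qed.

(* If S = x^2 and T is antidiagonal, the only ratio k : l other than 1 : 1 for which
   such a v exists for <S, T> is that of the two entries of T. *)
Definition has_asymmetry k l A := exists2 v : 'rV[F]_2, v != 0
  & k *: (v *m A.1) = l *: (v *m A.1^T) /\ k *: (v *m A.2) = l *: (v *m A.2^T).

Lemma has_asymmetry_congruent k l A B :
  pair_congruent A B -> has_asymmetry k l B -> has_asymmetry k l A.
Proof.
move=> [C [G [uC uG A1 A2]]] [v v0 [vB1 vB2]].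
have comb x y : k *: (v *m (x *: B.1 + y *: B.2)) =
                l *: (v *m (x *: B.1 + y *: B.2)^T).
  rewrite [(_ + _)^T]linearD /= ![(_ *: _)^T]linearZ /= !mulmxDr -!scalemxAr.
  rewrite !scalerDr !scalerA.
  by rewrite !(mulrC _ x) !(mulrC _ y) -!scalerA vB1 vB2.
have uCT : C^T \in unitmx by rewrite unitmx_tr.
have lift M : k *: (v *m (C *m M *m C^T)) = l *: (v *m (C *m M *m C^T)^T) ->
    k *: (v *m C *m M) = l *: (v *m C *m M^T).
  rewrite !trmx_mul trmxK !mulmxA !scalemxAl.
  by move/(can_inj (mulmxK uCT)).
exists (v *m C).
  by apply: contra v0 => /eqP /(canRL (mulmxK uC)) ->; rewrite mul0mx.
by split; apply: lift; rewrite ?A1 ?A2 comb.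
Qed.

End Matrices2.

(** * Pairs of matrices as structure tuples *)

Section Pairs.
Variable F : finFieldType.
Implicit Types A B : 'M[F]_2 * 'M[F]_2.

Definition tuple_of_pair A : 2.-tuple 'M[F]_2 := [tuple A.1; A.2].

Lemma tuple_of_pairK (A : 2.-tuple 'M[F]_2) :
  A = tuple_of_pair (tnth A 0, tnth A 1).
Proof.
case/tupleP: A => x A; case/tupleP: A => y A.
by apply: val_inj; rewrite (tuple0 A).
Qed.

Lemma ord2P (P : 'I_2 -> Prop) : P 0 -> P 1 -> forall k, P k.
Proof.
move=> P0 P1 [[|[|k]] // hk]; first by rewrite (_ : Ordinal hk = 0) //; apply: val_inj.
by rewrite (_ : Ordinal hk = 1) //; apply: val_inj.
Qed.

Lemma sum_ord2 (V : nmodType) (f : 'I_2 -> V) : \sum_i f i = f 0 + f 1.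
Proof.
rewrite !big_ord_recl big_ord0 addr0; congr (_ + f _); exact: val_inj.
Qed.

Lemma congruent_pair A B : pair_congruent A B ->
  congruent (tuple_of_pair A) (tuple_of_pair B).
Proof.
move/pair_congruent_sym=> [C [G [uC uG B1 B2]]].
exists C, G^T; rewrite unitmx_tr; split=> //.
by elim/ord2P; rewrite sum_ord2 !mxE.
Qed.

Lemma pair_of_congruent A B :
  congruent (tuple_of_pair A) (tuple_of_pair B) -> pair_congruent A B.
Proof.
move=> [C [G [uC uG AB]]]; apply: pair_congruent_sym; exists C, G^T.
rewrite unitmx_tr !mxE.
by split=> //; have := AB 0; have := AB 1; rewrite !sum_ord2.
Qed.

Lemma free_pair A : free (tuple_of_pair A) <-> independent A.
Proof.
split=> [/freeP fA x y xy0 | iA].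
  have := fA (fun i => if i == 0 then x else y).
  rewrite sum_ord2 /= => /(_ xy0) fA0.
  by split; [have := fA0 0 | have := fA0 1].
apply/freeP=> k; rewrite sum_ord2 /= => /iA[k0 k1].
by elim/ord2P.
Qed.

(** Bilinear forms on a plane that have a common nonzero vector in both radicals factor through a
    quotient line, so they span at most a line. *)
Lemma independent_zero_annihilator A :
  independent A -> zero_annihilator (tuple_of_pair A).
Proof.
case: A => A1 A2 iA u uA.
have := (uA 0, uA 1); rewrite /tnth /=.
rewrite [A1]mx2E [A2]mx2E in iA *.
move: (A1 0 0) (A1 0 1) (A1 1 0) (A1 1 1) (A2 0 0) (A2 0 1) (A2 1 0) (A2 1 1) iA.
move=> a b c d a' b' c' d' iA [[]].
have E (x y z t : F) : u *m mx2 x y z t = 0 ->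
    u 0 0 * x + u 0 1 * z = 0 /\ u 0 0 * y + u 0 1 * t = 0.
  move/rowP=> e; have := (e 0, e 1); rewrite !mxE !sum_ord2 !mxE /=.
  by move=> [-> ->].
rewrite !mx2T => /E[e1 e2] /E[e3 e4] [/E[e5 e6] /E[e7 e8]].
have e x y : x * a + y * a' = 0 -> x * b + y * b' = 0 -> x * c + y * c' = 0 ->
    x * d + y * d' = 0 -> x = 0 /\ y = 0.
  by move=> *; apply: iA; rewrite !mx2_simp mx2_0; congr mx2.
apply/eqP; apply: contraT => u0.
have e01 : (0 : F) = 0 /\ (1 : F) = 0 -> false.
  by case=> _ /eqP; rewrite oner_eq0.
have [u00 | u00] := eqVneq (u 0 0) 0.
  have u1 : u 0 1 != 0.
    apply: contra u0 => /eqP u01; apply/eqP/rowP; elim/ord2P; rewrite mxE //.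
  rewrite u00 !mul0r !add0r in e1 e2 e3 e4 e5 e6 e7 e8.
  have z x : u 0 1 * x = 0 -> x = 0.
    by move/eqP; rewrite mulf_eq0 (negPf u1) => /eqP.
  (* Only the top left entries survive, so [a'] and [- a] are the coefficients of a relation between
     the two matrices. *)
  have [a'0 _] : a' = 0 /\ - a = 0.
    by apply: e; rewrite ?(z _ e1) ?(z _ e2) ?(z _ e3) ?(z _ e5) ?(z _ e6)
      ?(z _ e7); ring.
  by apply: e01; apply: e; rewrite ?a'0 ?(z _ e5) ?(z _ e6) ?(z _ e7); ring.
have z x y : u 0 0 * x + u 0 1 * y = 0 -> x = - (u 0 1 / u 0 0) * y.
  by move/eqP; rewrite addr_eq0 => /eqP e0; apply: (mulfI u00); rewrite e0; field.
have [d'0 _] : d' = 0 /\ - d = 0.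
  by apply: e; rewrite ?(z _ _ e1) ?(z _ _ e5) ?(z _ _ e2) ?(z _ _ e6)
    ?(z _ _ e4) ?(z _ _ e8); ring.
by apply: e01; apply: e; rewrite ?(z _ _ e5) ?(z _ _ e6) ?(z _ _ e8) ?d'0; ring.
Qed.

Lemma zero_annihilator_compatible s t (A : t.-tuple 'M[F]_s) :
  free A -> zero_annihilator A -> compatible A.
Proof.
move=> fA ndA; split=> // i.
case: (boolP [exists j, exists k, (tnth A k i j != 0) || (tnth A k j i != 0)]).
  by move=> /existsP[j /existsP[k Ak]]; exists j, k.
move=> /existsPn Ai0; have Ai0' j k : tnth A k i j = 0 /\ tnth A k j i = 0.
  by have := Ai0 j => /existsPn/(_ k); rewrite negb_or !negbK => /andP[/eqP-> /eqP->].
have /rowP/(_ i) : delta_mx 0 i = 0 :> 'rV[F]_s.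
  by apply: ndA => k; split; apply/rowP=> j; rewrite -rowE !mxE; case: (Ai0' j k).
by rewrite !mxE !eqxx => /eqP; rewrite oner_eq0.
Qed.

(** The representatives indexed by [K1] are those giving commutative rings, so that the three counts
    are read off as cardinals. *)
Definition classifies (K1 K2 : finType) (rep : K1 + K2 -> 'M[F]_2 * 'M[F]_2) :=
  [/\ forall i, independent (rep i),
      forall i j, pair_congruent (rep i) (rep j) -> i = j,
      forall A, independent A -> exists i, pair_congruent A (rep i)
    & forall i, symmetric_pair (rep i) <-> is_inl i].

End Pairs.

(** * From congruence classes to isomorphism classes *)

Lemma num_iso_classes_fintype (K : finType) (P : finNzRingType -> Prop)
    (X : K -> finNzRingType) :
  (forall i, P (X i)) -> (forall i j, ring_iso (X i) (X j) -> i = j) ->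
  (forall R, P R -> exists i, ring_iso R (X i)) -> num_iso_classes P #|K|.
Proof.
move=> PX injX surjX; exists (X \o enum_val); split=> [i | i j /injX | R /surjX].
- exact: PX.
- exact: enum_val_inj.
by move=> [i RXi]; exists (enum_rank i); rewrite /= enum_rankK.
Qed.

Section Reduction.
Variables (p lam : nat) (hp : prime p) (K1 K2 : finType).
Variable rep : K1 + K2 -> 'M['F_p]_2 * 'M['F_p]_2.
Hypothesis rep_classifies : classifies rep.

Local Notation P := (ring_class p (1 + 2 + 2 + lam) 2 2 lam).
Local Notation X i := (constrA lam (tuple_of_pair (rep i))).

Let ring_class_rep i : P (X i).
Proof.
have [/(_ i) iA _ _ _] := rep_classifies.
have cA : compatible (tuple_of_pair (rep i)).
  apply: zero_annihilator_compatible; first exact/free_pair.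
  exact: independent_zero_annihilator.
split.
- exact: constrA_property_T.
- rewrite inE hp constrA_natmul /=; apply/eqP; congr (_, _, _).
  exact: (pcharf0 (pchar_Fp hp)).
- exact: constrA_residue_field.
split=> //; exists (tuple_of_pair (rep i)); split=> //.
by exists idfun; exists idfun.
Qed.

Let ring_iso_rep_inj i j : ring_iso (X i) (X j) -> i = j.
Proof.
have [iA inj _ _] := rep_classifies.
move=> ij; apply: inj; apply: pair_of_congruent.
apply: ring_iso_congruent ij; first exact/free_pair.
  exact: independent_zero_annihilator.
exact: independent_zero_annihilator.
Qed.

Let ring_class_iso_rep R : P R -> exists i, ring_iso R (X i).
Proof.
move=> [_ _ _ [_ _ _ [A [[fA _] RA]]]].
have [_ _ surj _] := rep_classifies.
move: fA RA; rewrite [A]tuple_of_pairK => /free_pair/surj[i Ai] RA.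
by exists i; apply: ring_iso_trans RA _; exact/congruent_ring_iso/congruent_pair.
Qed.

Let commutative_rep i : commutative_ring (X i) <-> is_inl i.
Proof.
have [_ _ _ <-] := rep_classifies; rewrite constrA_commutative.
split=> [symA | [sym1 sym2]]; last by elim/ord2P.
by split; [exact: (symA 0) | exact: (symA 1)].
Qed.

Lemma classifies_num_iso_classes :
  [/\ num_iso_classes P (#|K1| + #|K2|),
      num_iso_classes (fun R => P R /\ commutative_ring R) #|K1|
    & num_iso_classes (fun R => P R /\ ~ commutative_ring R) #|K2|].
Proof.
split.
- rewrite -card_sum; exact: num_iso_classes_fintype ring_iso_rep_inj _.
- apply: (num_iso_classes_fintype (X := fun i => X (inl i))).
  + by move=> i; split=> //; apply/commutative_rep.
  + by move=> i j /ring_iso_rep_inj[].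
  move=> R [/ring_class_iso_rep[i Ri] comR].
  have /commutative_rep := (ring_iso_commutative Ri).1 comR.
  by case: i Ri => // i Ri _; exists i.
apply: (num_iso_classes_fintype (X := fun i => X (inr i))).
+ by move=> i; split=> // /commutative_rep.
+ by move=> i j /ring_iso_rep_inj[].
move=> R [/ring_class_iso_rep[i Ri] ncomR].
case: i Ri => i Ri; last by exists i.
by case: ncomR; apply/(ring_iso_commutative Ri)/commutative_rep.
Qed.

End Reduction.

(** * Odd characteristic *)

Section Preservation.
Variable F : fieldType.
Implicit Types A B : 'M[F]_2 * 'M[F]_2.

Lemma independent_congruent A B :
  pair_congruent A B -> independent A -> independent B.
Proof.
move=> /pair_congruent_sym[C [G [uC uG B1 B2]]] iA x y xy0.
have : C *m (x *: B.1 + y *: B.2) *m C^T = 0 by rewrite xy0 mulmx0 mul0mx.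
rewrite mulmxDr mulmxDl -!scalemxAr -!scalemxAl B1 B2 !scalerDr !scalerA.
rewrite addrACA -!scalerDl => /iA[e0 e1].
have /rowP xyG0 : (\row_i (if i == 0 then x else y)) *m G = 0.
  apply/rowP=> j; rewrite !mxE !big_ord_recl big_ord0 !mxE /= addr0.
  rewrite (_ : lift 0 0 = 1); last exact: val_inj.
  by case: j => [[|[|j]] // hj]; [rewrite -[RHS]e0 | rewrite -[RHS]e1];
    congr (_ * G _ _ + _ * G _ _); apply: val_inj.
have /rowP xy : (\row_i (if i == 0 then x else y)) = 0 :> 'rV[F]_2.
  by rewrite -[LHS](mulmxK uG) (_ : _ *m G = 0) ?mul0mx //; apply/rowP.
by have := (xy 0, xy 1); rewrite !mxE /= => -[-> ->].
Qed.

Lemma symmetric_pair_congruent A B :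
  pair_congruent A B -> symmetric_pair A -> symmetric_pair B.
Proof.
move=> /pair_congruent_sym[C [G [uC uG B1 B2]]] [sA1 sA2].
have uCT : C^T \in unitmx by rewrite unitmx_tr.
have comb x y M : C *m M *m C^T = x *: A.1 + y *: A.2 -> M^T = M.
  move=> CM; apply: (can_inj (mulKmx uC)); apply: (can_inj (mulmxK uCT)).
  rewrite CM -mulmxA; have := congr1 trmx CM.
  by rewrite !trmx_mul trmxK => ->; rewrite linearD !linearZ /= sA1 sA2.
by split; [apply: comb B1 | apply: comb B2].
Qed.

(** Serves to give explicit congruences by eight scalars, the entries of [C] and then those of [G];
    what remains is checked entry by entry. *)
Lemma pair_congruentI p q r s g h k l A B :
  p * s - q * r != 0 -> g * l - h * k != 0 ->
  mx2 p q r s *m A.1 *m (mx2 p q r s)^T = g *: B.1 + h *: B.2 ->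
  mx2 p q r s *m A.2 *m (mx2 p q r s)^T = k *: B.1 + l *: B.2 ->
  pair_congruent A B.
Proof.
move=> C0 G0 A1 A2; exists (mx2 p q r s), (mx2 g h k l).
by rewrite !unitmxE !det_mx2 !unitfE C0 G0 !mx2_entries.
Qed.

Lemma pair_congruent_base1 A x y : ~~ ((x == 0) && (y == 0)) ->
  exists M, pair_congruent A (x *: A.1 + y *: A.2, M).
Proof.
rewrite negb_and => /orP[x0 | y0].
  exists (0 *: A.1 + 1 *: A.2); apply: pair_congruent_base.
  by rewrite mulr1 mulr0 subr0.
exists (1 *: A.1 + 0 *: A.2); apply: pair_congruent_base.
by rewrite mulr1 mulr0 sub0r oppr_eq0.
Qed.

Lemma independent_fst A : independent A -> A.1 <> 0.
Proof.
move=> iA A0; have [] := iA 1 0; first by rewrite A0 scaler0 scale0r addr0.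
by move/eqP; rewrite oner_eq0.
Qed.

End Preservation.

Section Odd.
Variables (F : finFieldType) (eps : F) (nm : F -> F * F).
Hypothesis two_neq0 : (2 : F) != 0.
Hypothesis eps_nonsquare : forall x, x ^+ 2 != eps.
Hypothesis square_or_eps : forall a, exists x, a = x ^+ 2 \/ a = eps * x ^+ 2.
Hypothesis nmP : forall c, (nm c).1 ^+ 2 - eps * (nm c).2 ^+ 2 = c.
Implicit Types A B : 'M[F]_2 * 'M[F]_2.

Local Notation E11 := (mx2 1 0 0 (0 : F)).
Local Notation E22 := (mx2 0 0 0 (1 : F)).
Local Notation H := (mx2 0 1 1 (0 : F)).
Local Notation Eps := (mx2 1 0 0 (- eps)).

(** The determinant of x times the first member plus y times the second is respectively - y^2, xy
    and eps y^2 - x^2: degenerate, split, anisotropic. *)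
Definition commutative_rep (i : option bool) : 'M[F]_2 * 'M[F]_2 :=
  match i with
  | None => (E11, H)
  | Some true => (E11, E22)
  | Some false => (H, mx2 1 0 0 eps)
  end.

(* The members are grouped by the congruence class, up to a scalar, of the
   line of symmetric matrices of the span: [E11], [H] or [Eps]. *)
Definition noncommutative_rep (i : option F + option F + F) :
    'M[F]_2 * 'M[F]_2 :=
  match i with
  | inl (inl (Some t)) => (E11, mx2 0 (t + 1) t 0)
  | inl (inl None) => (E11, mx2 0 1 0 1)
  | inl (inr (Some b)) => (H, mx2 1 1 0 b)
  | inl (inr None) => (H, mx2 0 1 0 0)
  | inr c => (Eps, let: (n, m) := nm c in mx2 (2 * m) (n + 1) (n - 1) 0)
  end.

Definition odd_rep (i : option bool + (option F + option F + F)) :=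
  match i with inl i => commutative_rep i | inr i => noncommutative_rep i end.

(** * Normal forms in odd characteristic *)

Let eps_neq0 : eps != 0.
Proof. by have := eps_nonsquare 0; rewrite expr0n eq_sym. Qed.

Let four_neq0 : (4 : F) != 0.
Proof. by rewrite (natrM _ 2 2) mulf_neq0. Qed.

Let anisotropic u v : u ^+ 2 - eps * v ^+ 2 = 0 -> u = 0 /\ v = 0.
Proof.
move=> uv; have [v0 | v0] := eqVneq v 0.
  by move: uv; rewrite v0 expr0n mulr0 subr0 => /eqP; rewrite sqrf_eq0 => /eqP.
have := eps_nonsquare (u / v).
by rewrite expr_div_n (subr0_eq uv) mulfK ?eqxx ?expf_neq0.
Qed.

Lemma odd_symmetric A : independent A -> symmetric_pair A ->
  exists i, pair_congruent A (commutative_rep i).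
Proof.
move=> iA sA.
(* The combination of [A.1] and [A.2] with coefficients [A.2 0 0] and [- A.1 0 0] has top left entry
   0; if both coefficients vanish, [A.1] itself will do. *)
have [M [b [d AM]]] : exists M b d, pair_congruent A (mx2 0 b b d, M).
  have [xy | xy] := boolP ((A.2 0 0 == 0) && (- A.1 0 0 == 0)).
    exists A.2, (A.1 0 1), (A.1 1 1); case/andP: xy => _; rewrite oppr_eq0 => /eqP a0.
    rewrite (_ : mx2 _ _ _ _ = A.1); last first.
      by rewrite [RHS]mx2E a0 -[in A.1 1 0]sA.1 mxE.
    exists 1%:M, 1%:M; rewrite !unitmx1 !mxE /= !mul1mx trmx1 !mulmx1.
    by rewrite !scale1r !scale0r addr0 add0r.
  have [M AM] := pair_congruent_base1 A xy.
  move: AM; set A' := _ + _ => AM; exists M, (A' 0 1), (A' 1 1).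
  rewrite (_ : mx2 _ _ _ _ = A') //; rewrite [RHS]mx2E.
  have sA' : A'^T = A' by rewrite linearD !linearZ /= sA.1 sA.2.
  by congr mx2; [rewrite /A' !mxE; ring | rewrite -{2}sA' [RHS]mxE].
have iM := independent_congruent AM iA.
have sM := (symmetric_pair_congruent AM sA).2.
suff [i Mi] : exists i, pair_congruent (mx2 0 b b d, M) (commutative_rep i).
  by exists i; apply: pair_congruent_trans AM Mi.
rewrite /= in sM; move: sM {AM} iM; rewrite [M]mx2E mx2T => /mx2_inj[_ -> _ _].
move: (M 0 0) (M 0 1) (M 1 1) => a' b' d' iM.
have [b0 | b0] := eqVneq b 0.
  have d0 : d != 0.
    by apply/eqP => d0; apply: (independent_fst iM); rewrite b0 d0 mx2_0.
  have [a0 | a0] := eqVneq a' 0.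
    have b'0 : b' != 0.
      apply/eqP=> b'0; have [] := iM (- d') d.
        by rewrite !mx2_simp mx2_0 b0 a0 b'0; congr mx2; ring.
      by move=> _ /eqP; rewrite (negPf d0).
    exists None; apply: (@pair_congruentI _ 0 1 1 0 d 0 d' b').
    - by rewrite mul0r sub0r mulr1 oppr_eq0 oner_eq0.
    - by rewrite mul0r subr0 mulf_neq0.
    - by rewrite !mx2_simp b0; congr mx2; ring.
    - by rewrite !mx2_simp a0; congr mx2; ring.
  exists (Some true).
  apply: (@pair_congruentI _ 1 0 (- b' / a') 1 0 d a' (d' - b' ^+ 2 / a')).
  - by rewrite mul0r subr0 mulr1 oner_eq0.
  - by rewrite mul0r sub0r oppr_eq0 mulf_neq0.
  - by rewrite !mx2_simp b0; congr mx2; ring.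
  - by rewrite !mx2_simp; congr mx2; field.
have [a [e [MM ae]]] : exists a e,
    pair_congruent (mx2 0 b b d, mx2 a' b' b' d') (H, mx2 a 0 0 e)
    /\ ~~ ((a == 0) && (e == 0)).
  (* This shear turns the first matrix into [b *: H]; a multiple of [H] then clears the off-diagonal
     entries of the second. *)
  pose t := - d / (2 * b).
  exists a', (d' + 2 * t * b' + t ^+ 2 * a').
  have MM : pair_congruent (mx2 0 b b d, mx2 a' b' b' d')
                           (H, mx2 a' 0 0 (d' + 2 * t * b' + t ^+ 2 * a')).
    apply: (@pair_congruentI _ 1 0 t 1 b 0 (b' + t * a') 1).
    - by rewrite mul0r subr0 mulr1 oner_eq0.
    - by rewrite mul0r subr0 mulr1.
    - by rewrite !mx2_simp /t; congr mx2; field; rewrite ?two_neq0 ?b0.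
    - by rewrite !mx2_simp; congr mx2; ring.
  split=> //; apply/andP=> -[/eqP a0 /eqP d0].
  have := independent_congruent MM iM; rewrite d0 a0 => /(_ 0 1) /=.
  rewrite -mx2_0 scaler0 scale0r addr0 => /(_ erefl)[_ /eqP].
  by rewrite oner_eq0.
suff [i Mi] : exists i, pair_congruent (H, mx2 a 0 0 e) (commutative_rep i).
  by exists i; apply: pair_congruent_trans MM Mi.
have [a0 | a0] := eqVneq a 0.
  exists None; rewrite a0 eqxx /= in ae *.
  apply: (@pair_congruentI _ 0 1 1 0 0 1 e 0).
  - by rewrite mul0r sub0r mulr1 oppr_eq0 oner_eq0.
  - by rewrite mul0r sub0r mul1r oppr_eq0.
  - by rewrite !mx2_simp; congr mx2; ring.
  - by rewrite !mx2_simp; congr mx2; ring.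
have [e0 | e0] := eqVneq e 0.
  exists None; rewrite e0.
  apply: (@pair_congruentI _ 1 0 0 1 0 1 a 0).
  - by rewrite mul0r subr0 mulr1 oner_eq0.
  - by rewrite mul0r sub0r mul1r oppr_eq0.
  - by rewrite !mx2_simp; congr mx2; ring.
  - by rewrite !mx2_simp; congr mx2; ring.
(* The determinant of x H + y diag(a, e) is a e y^2 - x^2, split or anisotropic according to the
   square class of [e / a]. *)
have [z zP] := square_or_eps (e / a).
have z0 : z != 0.
  apply/eqP=> z0; have : e / a = 0.
    by case: zP => ->; rewrite z0 expr0n ?mulr0.
  by apply/eqP; rewrite mulf_neq0 ?invr_eq0.
case: zP => [] ez; have {}ez := canRL (divfK a0) ez; subst e.
  exists (Some true).
  (* The rows (z, 1) and (z, -1) form a basis orthogonal for both forms. *)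
  apply: (@pair_congruentI _ z 1 z (-1) (2 * z) (- (2 * z))
            (2 * (z ^+ 2 * a)) (2 * (z ^+ 2 * a))).
  - by rewrite (_ : _ - _ = - (2 * z)) ?oppr_eq0 ?mulf_neq0 //; ring.
  - by rewrite (_ : _ - _ = 4 * (2 * (z * z ^+ 2 * a))) ?mulf_neq0 ?expf_neq0 //; ring.
  - by rewrite !mx2_simp; congr mx2; ring.
  - by rewrite !mx2_simp; congr mx2; ring.
exists (Some false).
apply: (@pair_congruentI _ 1 0 0 z^-1 z^-1 0 0 a).
- by rewrite mul0r subr0 mul1r invr_eq0.
- by rewrite mul0r subr0 mulf_neq0 ?invr_eq0.
- by rewrite !mx2_simp; congr mx2; ring.
- by rewrite !mx2_simp; congr mx2; field.
Qed.


Lemma symmetric_normal_form (S T : 'M[F]_2) : S^T = S -> S <> 0 ->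
  exists N U, (N = E11 \/ N = H \/ N = Eps) /\ pair_congruent (S, T) (N, U).
Proof.
rewrite [S]mx2E mx2T => /mx2_inj[_ _ -> _].
move: (S 0 0) (S 1 0) (S 1 1) => {S} a b d S0.
(* Exchanging the coordinates gives [a != 0], unless both diagonal entries vanish and S is a
   multiple of [H]. *)
wlog a0 : a d T S0 / (a != 0) || (d == 0) => [IH |].
  case: (boolP ((a != 0) || (d == 0))) => [|]; first exact: IH.
  rewrite negb_or negbK => /andP[/eqP a0 d0].
  have ST : pair_congruent (mx2 a b b d, T)
      (mx2 d b b a, mx2 0 1 1 0 *m T *m (mx2 0 1 1 0)^T).
    apply: (@pair_congruentI _ 0 1 1 0 1 0 0 1).
    - by rewrite mul0r sub0r mulr1 oppr_eq0 oner_eq0.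
    - by rewrite mul0r subr0 mulr1 oner_eq0.
    - by rewrite scale0r addr0 !mx2_simp; congr mx2; ring.
    - by rewrite scale0r add0r scale1r.
  have [||N [U [NE SU]]] := IH d a (mx2 0 1 1 0 *m T *m (mx2 0 1 1 0)^T).
  - by rewrite mx2_0 => /mx2_inj[/eqP]; rewrite (negPf d0).
  - by rewrite d0.
  by exists N, U; split=> //; apply: pair_congruent_trans ST SU.
have norm p q r s x N : p * s - q * r != 0 -> x != 0 ->
    mx2 p q r s *m mx2 a b b d *m (mx2 p q r s)^T = x *: N ->
    N = E11 \/ N = H \/ N = Eps -> exists N U,
    (N = E11 \/ N = H \/ N = Eps) /\ pair_congruent (mx2 a b b d, T) (N, U).
  move=> C0 x0 CS NE; exists N, (mx2 p q r s *m T *m (mx2 p q r s)^T).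
  split=> //; apply: (@pair_congruentI _ p q r s x 0 0 1) => //.
  - by rewrite mul0r subr0 mulr1.
  - by rewrite scale0r addr0.
  - by rewrite scale0r add0r scale1r.
have [az | {}a0] := eqVneq a 0.
  rewrite az eqxx /= in a0; rewrite (eqP a0) az in S0 norm *.
  have b0 : b != 0 by apply/eqP=> b0; apply: S0; rewrite b0 mx2_0.
  apply: (norm 1 0 0 1 b H) => //; last by right; left.
    by rewrite mul0r subr0 mulr1 oner_eq0.
  by rewrite !mx2_simp; congr mx2; ring.
(* With X = x + (b / a) y, the form S is a (X^2 - k y^2), where k is the argument given here. *)
have [z [] ez] := square_or_eps (- (d - b ^+ 2 / a) / a).
  have {ez} dE : d = b ^+ 2 / a - a * z ^+ 2 by rewrite -ez; field.
  subst d; have [z0 | z0] := eqVneq z 0.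
    apply: (norm 1 0 (- b / a) 1 a E11) => //; last by left.
      by rewrite mul0r subr0 mulr1 oner_eq0.
    by rewrite z0 !mx2_simp; congr mx2; field.
  (* The rows are the isotropic vectors with X = 1 and z y = 1 or -1; they pair to [2 * a]. *)
  apply: (norm (1 - b / a / z) z^-1 (1 + b / a / z) (- z^-1) (2 * a) H) => //.
  - rewrite (_ : _ - _ = - (2 / z)); last by field; rewrite ?z0 ?a0.
    by rewrite oppr_eq0 mulf_neq0 ?invr_eq0.
  - by rewrite mulf_neq0.
  - by rewrite !mx2_simp; congr mx2; field; rewrite ?z0 ?a0.
  - by right; left.
have {ez} dE : d = b ^+ 2 / a - a * (eps * z ^+ 2) by rewrite -ez; field.
subst d; have [z0 | z0] := eqVneq z 0.
  apply: (norm 1 0 (- b / a) 1 a E11) => //; last by left.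
    by rewrite mul0r subr0 mulr1 oner_eq0.
  by rewrite z0 !mx2_simp; congr mx2; field.
apply: (norm 1 0 (- b / a / z) z^-1 a Eps) => //; last by right; right.
  by rewrite mul0r subr0 mul1r invr_eq0.
by rewrite !mx2_simp; congr mx2; field; rewrite ?z0 ?a0.
Qed.

(* Hilbert 90 for F(sqrt eps) / F: two elements n + m sqrt eps of the same norm
   differ by a factor l / conj l, where l = x + y sqrt eps. *)
Lemma hilbert90 n m n' m' :
  n ^+ 2 - eps * m ^+ 2 = n' ^+ 2 - eps * m' ^+ 2 ->
  exists x y, [/\ x ^+ 2 - eps * y ^+ 2 != 0,
    n * x + eps * m * y = n' * x - eps * m' * y
  & n * y + m * x = m' * x - n' * y].
Proof.
move=> eN; have [nm0 | nm0] := boolP ((n + n' == 0) && (m + m' == 0)).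
  case/andP: nm0; rewrite !addr_eq0 => /eqP-> /eqP->; exists 0, 1.
  by split; [rewrite expr0n expr1n sub0r mulr1 oppr_eq0 | ring | ring].
have N0 : n ^+ 2 - eps * m ^+ 2 != 0.
  apply: contra nm0 => /eqP N0; have [-> ->] := anisotropic N0.
  by rewrite eN in N0; have [-> ->] := anisotropic N0; rewrite addr0 eqxx.
(* Writing alpha = n + m sqrt eps and alpha' = n' + m' sqrt eps, this is l = conj(alpha) (alpha +
   alpha'), whose norm is N(alpha) N(alpha + alpha'). *)
exists (n ^+ 2 - eps * m ^+ 2 + n' * n - eps * m' * m), (m' * n - n' * m).
split.
- rewrite (_ : _ - _ = (n ^+ 2 - eps * m ^+ 2)
                       * ((n + n') ^+ 2 - eps * (m + m') ^+ 2)); last first.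
    apply/eqP; rewrite -subr_eq0; apply/eqP.
    transitivity ((n ^+ 2 - eps * m ^+ 2)
      * (n ^+ 2 - eps * m ^+ 2 - (n' ^+ 2 - eps * m' ^+ 2)) * 0); first by ring.
    by rewrite mulr0.
  rewrite mulf_neq0 //; apply: contra nm0 => /eqP/anisotropic[-> ->].
  by rewrite eqxx.
- apply/eqP; rewrite -subr_eq0; apply/eqP.
  transitivity (n * (n ^+ 2 - eps * m ^+ 2 - (n' ^+ 2 - eps * m' ^+ 2))).
    by ring.
  by rewrite eN subrr mulr0.
apply/eqP; rewrite -subr_eq0; apply/eqP.
transitivity (m * (n ^+ 2 - eps * m ^+ 2 - (n' ^+ 2 - eps * m' ^+ 2))).
  by ring.
by rewrite eN subrr mulr0.
Qed.

Lemma odd_rank1 a b c d : b - c != 0 ->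
  exists i, pair_congruent (E11, mx2 a b c d) (noncommutative_rep (inl (inl i))).
Proof.
move=> k0; have [d0 | d0] := eqVneq d 0.
  exists (Some (c / (b - c))); rewrite d0.
  apply: (@pair_congruentI _ 1 0 0 1 1 0 a (b - c)).
  - by rewrite mul0r subr0 mulr1 oner_eq0.
  - by rewrite mul0r subr0 mul1r.
  - by rewrite !mx2_simp; congr mx2; ring.
  - by rewrite !mx2_simp; congr mx2; field.
(* These values make the off-diagonal entries of the transformed second matrix equal to [d] and
   0. *)
exists None; pose p := d / (b - c); pose q := - c / (b - c).
apply: (@pair_congruentI _ p q 0 1 (p ^+ 2) 0
          (a * p ^+ 2 + (b + c) * p * q + d * q ^+ 2) d).
- by rewrite mulr0 subr0 mulr1 mulf_neq0 ?invr_eq0.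
- by rewrite mul0r subr0 mulf_neq0 // expf_neq0 // mulf_neq0 ?invr_eq0.
- by rewrite !mx2_simp; congr mx2; ring.
- by rewrite !mx2_simp /p /q; congr mx2; field.
Qed.

Lemma odd_hyperbolic a b c d : b - c != 0 ->
  exists i, pair_congruent (H, mx2 a b c d) (noncommutative_rep (inl (inr i))).
Proof.
move=> k0; have [a0 | a0] := eqVneq a 0; last first.
  (* Rescaling the second coordinate makes the skew coefficient equal to the top left entry [a]; the
     ratio [a * d / (b - c) ^+ 2] is unaffected. *)
  exists (Some (a * d / (b - c) ^+ 2)).
  apply: (@pair_congruentI _ 1 0 0 (a / (b - c)) (a / (b - c)) 0
            (c * (a / (b - c))) a).
  - by rewrite mul0r subr0 mul1r mulf_neq0 ?invr_eq0.
  - by rewrite mul0r subr0 !mulf_neq0 ?invr_eq0.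
  - by rewrite !mx2_simp; congr mx2; ring.
  - by rewrite !mx2_simp; congr mx2; field.
rewrite a0; have [d0 | d0] := eqVneq d 0.
  exists None; rewrite d0.
  apply: (@pair_congruentI _ 1 0 0 1 1 0 c (b - c)).
  - by rewrite mul0r subr0 mulr1 oner_eq0.
  - by rewrite mul0r subr0 mul1r.
  - by rewrite !mx2_simp; congr mx2; ring.
  - by rewrite !mx2_simp; congr mx2; ring.
(* The coordinates are exchanged to bring [d] to the top left, and [y] makes the skew coefficient
   equal to [d]. *)
exists (Some 0); pose y := - d / (b - c).
have y0 : y != 0 by rewrite mulf_neq0 ?invr_eq0 ?oppr_eq0.
apply: (@pair_congruentI _ 0 1 y 0 y 0 (b * y) d).
- by rewrite mul0r sub0r mul1r oppr_eq0.
- by rewrite mul0r subr0 mulf_neq0.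
- by rewrite !mx2_simp; congr mx2; ring.
- by rewrite !mx2_simp /y; congr mx2; field.
Qed.

Lemma odd_anisotropic a b c d : b - c != 0 ->
  exists i, pair_congruent (Eps, mx2 a b c d) (noncommutative_rep (inr i)).
Proof.
(* Clearing the bottom right entry with a multiple of [Eps] and scaling the skew coefficient to 2
   leaves a matrix with coordinates [n] and [m]. *)
move=> k0; pose m := (a + d / eps) / (b - c); pose n := (b + c) / (b - c).
exists (n ^+ 2 - eps * m ^+ 2).
have k20 : (b - c) / 2 != 0 by rewrite mulf_neq0 ?invr_eq0.
apply: (@pair_congruent_trans _ _ (Eps, mx2 (2 * m) (n + 1) (n - 1) 0)).
  apply: (@pair_congruentI _ 1 0 0 1 1 0 (- d / eps) ((b - c) / 2)).
  - by rewrite mul0r subr0 mulr1 oner_eq0.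
  - by rewrite mul0r subr0 mul1r.
  - by rewrite !mx2_simp; congr mx2; ring.
  - by rewrite !mx2_simp /m /n; congr mx2; field; rewrite ?k0 ?two_neq0 ?eps_neq0.
rewrite /=; have := nmP (n ^+ 2 - eps * m ^+ 2); case: (nm _) => n' m' /= eN.
have [x [y [xy0 e1 e2]]] := hilbert90 (esym eN).
(* [C] is multiplication by l = x + y sqrt eps in the basis 1, sqrt eps; it multiplies the norm form
   [Eps] by the norm of l. *)
apply: (@pair_congruentI _ x y (eps * y) x (x ^+ 2 - eps * y ^+ 2) 0
          (- (2 * m * eps * y ^+ 2 + 2 * n * x * y)) (x ^+ 2 - eps * y ^+ 2)).
- by rewrite (_ : _ - _ = x ^+ 2 - eps * y ^+ 2) //; ring.
- by rewrite mul0r subr0 mulf_neq0.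
- by rewrite !mx2_simp; congr mx2; ring.
(* This identity and the next are the coordinates of N(l) alpha' = l^2 alpha. *)
have m'E : (x ^+ 2 - eps * y ^+ 2) * m' =
    m * (x ^+ 2 + eps * y ^+ 2) + 2 * n * x * y.
  transitivity (x * (m' * x - n' * y) + y * (n' * x - eps * m' * y)); first by ring.
  by rewrite -e1 -e2; ring.
have n'E : (x ^+ 2 - eps * y ^+ 2) * n' =
    n * (x ^+ 2 + eps * y ^+ 2) + 2 * m * eps * x * y.
  transitivity (x * (n' * x - eps * m' * y) + eps * y * (m' * x - n' * y)).
    by ring.
  by rewrite -e1 -e2; ring.
rewrite !mx2_simp [_ * (2 * m')]mulrCA m'E.
by rewrite [_ * (n' + 1)]mulrDr [_ * (n' - 1)]mulrDr n'E; congr mx2; ring.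
Qed.

Lemma odd_nonsymmetric A : independent A -> ~ symmetric_pair A ->
  exists i, pair_congruent A (noncommutative_rep i).
Proof.
move=> iA nsA.
have skewP M : skew_coef M = 0 -> M^T = M.
  by rewrite [M]mx2E mx2T /skew_coef !mx2_entries => /subr0_eq->.
(* These are the coefficients of [symmetric_part]; the first basis vector of the span is taken to be
   this symmetric matrix. *)
have xy0 : ~~ ((skew_coef A.2 == 0) && (- skew_coef A.1 == 0)).
  apply/andP=> -[/eqP s2]; rewrite oppr_eq0 => /eqP s1.
  by apply: nsA; split; apply: skewP.
have [M AM] := pair_congruent_base1 A xy0.
have iM := independent_congruent AM iA.
have sS : (skew_coef A.2 *: A.1 + - skew_coef A.1 *: A.2)^T
          = skew_coef A.2 *: A.1 + - skew_coef A.1 *: A.2.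
  by apply: skewP; rewrite /skew_coef !mxE; ring.
have [N [U [NE SU]]] := symmetric_normal_form M sS (independent_fst iM).
have {M iM xy0 AM sS SU} AU := pair_congruent_trans AM SU.
have U0 : U 0 1 - U 1 0 != 0.
  apply/eqP=> /skewP sU; apply: nsA.
  apply: (symmetric_pair_congruent (pair_congruent_sym AU)); split=> //=.
  by case: NE => [|[]] ->; rewrite mx2T.
move: AU; rewrite [U]mx2E => AU.
case: NE => [|[]] NE; rewrite {}NE in AU.
- have [i Ui] := odd_rank1 (U 0 0) (U 1 1) U0.
  by exists (inl (inl i)); apply: pair_congruent_trans AU Ui.
- have [i Ui] := odd_hyperbolic (U 0 0) (U 1 1) U0.
  by exists (inl (inr i)); apply: pair_congruent_trans AU Ui.
have [i Ui] := odd_anisotropic (U 0 0) (U 1 1) U0.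
by exists (inr i); apply: pair_congruent_trans AU Ui.
Qed.

(** * Separation of the representatives in odd characteristic *)

Lemma odd_rep_independent i : independent (odd_rep i).
Proof.
move=> x y; case: i => [[[]|] | [[[t|]|[b|]]|c]] /=; last first;
  [case: (nm c) => n m|..]; rewrite !mx2_simp mx2_0 => /mx2_inj[];
  rewrite ?mulr0 ?mulr1 ?add0r ?addr0; try by move=> *; split.
- move=> e1 /eqP e2 /eqP e3 /eqP e4.
  move: e4; rewrite mulf_eq0 oppr_eq0 (negPf eps_neq0) orbF => /eqP x0.
  split=> //; apply/eqP; apply: contraT => y0.
  move: e2 e3; rewrite !mulf_eq0 (negPf y0) /= => /eqP e2 /eqP e3.
  have /eqP : (2 : F) = 0 by rewrite -[RHS]subr0 -{1}e2 -e3; ring.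
  by rewrite (negPf two_neq0).
- by move=> _ xy x0 _; move: xy; rewrite x0 add0r.
- move=> x0 e1 e2 _; split=> //.
  have -> : y = y * (t + 1) - y * t by ring.
  by rewrite e1 e2 subrr.
Qed.

Lemma odd_rep_symmetric i : symmetric_pair (odd_rep i) <-> is_inl i.
Proof.
case: i => [[[]|] | [[[t|]|[b|]]|c]]; split=> //=; rewrite /symmetric_pair /= ?mx2T //.
- by case=> _ /mx2_inj[_ /eqP]; rewrite eq_sym addrC -subr_eq0 addrK oner_eq0.
- by case=> _ /mx2_inj[_ /eqP]; rewrite eq_sym oner_eq0.
- by case=> _ /mx2_inj[_ /eqP]; rewrite eq_sym oner_eq0.
- by case=> _ /mx2_inj[_ /eqP]; rewrite eq_sym oner_eq0.
case: (nm c) => n m; rewrite mx2T => -[_ /mx2_inj[_ /eqP]].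
rewrite eq_sym -subr_eq0 (_ : n + 1 - (n - 1) = 2); last by ring.
by rewrite (negPf two_neq0).
Qed.

Definition square_class (a : F) := (a == 0, [exists y, a == y ^+ 2]).

Lemma square_classM r a : r != 0 -> square_class (r ^+ 2 * a) = square_class a.
Proof.
move=> r0; congr (_, _); first by rewrite mulf_eq0 expf_eq0 (negPf r0).
apply/existsP/existsP=> -[y /eqP ay].
  exists (y / r); rewrite expr_div_n -ay mulrAC mulfV ?mul1r ?expf_neq0 //.
by exists (r * y); rewrite ay exprMn.
Qed.

(** The discriminant separates the three symmetric classes; for the others, minus the determinant of
    the symmetric part being zero, a square or a nonsquare tells [E11], [H] and [Eps] apart. *)
Definition signature A :=
  (symmetric_part A == 0, square_class (- \det (symmetric_part A)),
   square_class (disc A)).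

Lemma signature_congruent A B : pair_congruent A B -> signature A = signature B.
Proof.
move=> /pair_congruent_covariants[S1 S2 [r r0 [eS eD]]].
rewrite /signature eS eD -mulrN !square_classM //; congr (_, _, _).
by apply/eqP/eqP.
Qed.

Let square_class0 : square_class 0 = (true, true).
Proof.
by congr (_, _); rewrite ?eqxx //; apply/existsP; exists 0; rewrite expr0n.
Qed.

Let square_class_sqr a : a != 0 -> square_class (a ^+ 2) = (false, true).
Proof.
move=> a0; congr (_, _); first by rewrite expf_eq0 (negPf a0).
by apply/existsP; exists a.
Qed.

Let square_class_eps a : a != 0 -> square_class (a ^+ 2 * eps) = (false, false).
Proof.
move=> a0; rewrite square_classM //; congr (_, _); first exact: negPf.
by apply/existsP=> -[y]; rewrite eq_sym (negPf (eps_nonsquare y)).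
Qed.

Lemma signature_rep i :
  match i with
  | inl None => signature (odd_rep i) = (true, (true, true), (true, true))
  | inl (Some true) => signature (odd_rep i) = (true, (true, true), (false, true))
  | inl (Some false) => signature (odd_rep i) = (true, (true, true), (false, false))
  | inr (inl (inl (Some _))) =>
      signature (odd_rep i) = (false, (true, true), (true, true))
  | inr (inl (inl None)) =>
      signature (odd_rep i) = (false, (true, true), (false, true))
  | inr (inl (inr _)) => exists D, signature (odd_rep i) = (false, (false, true), D)
  | inr (inr _) => exists D, signature (odd_rep i) = (false, (false, false), D)
  end.
Proof.
have mx2_eq0 a b c d :
    (mx2 a b c d == 0 :> 'M[F]_2) = [&& a == 0, b == 0, c == 0 & d == 0].
  apply/eqP/and4P=> [|[/eqP-> /eqP-> /eqP-> /eqP->]]; last by rewrite -mx2_0.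
  by rewrite mx2_0 => /mx2_inj[-> -> -> ->].
(* Evaluates a signature from simplified values: [S0] to [S3] for the symmetric part, [K] for minus
   its determinant, [D] for the discriminant. *)
have sigE a b c d a' b' c' d' S0 S1 S2 S3 K D :
    [/\ (b' - c') * a - (b - c) * a' = S0, (b' - c') * b - (b - c) * b' = S1,
        (b' - c') * c - (b - c) * c' = S2 & (b' - c') * d - (b - c) * d' = S3] ->
    - (S0 * S3 - S1 * S2) = K ->
    (a * d' + a' * d - b * c' - b' * c) ^+ 2
      - 4 * (a * d - b * c) * (a' * d' - b' * c') = D ->
    signature (mx2 a b c d, mx2 a' b' c' d') =
    ([&& S0 == 0, S1 == 0, S2 == 0 & S3 == 0], square_class K, square_class D).
  move=> [<- <- <- <-] <- <-.
  rewrite /signature /symmetric_part /disc /skew_coef /= -scaleNr.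
  rewrite !mx2_entries !mx2_simp.
  by rewrite mx2_eq0 !mulNr.
have one0 := oner_eq0 F.
case: i => [[[]|] | [[[t|]|[b|]]|c]] /=.
- rewrite (@sigE _ _ _ _ _ _ _ _ 0 0 0 0 0 (1 ^+ 2));
    try (split; ring); try ring.
  by rewrite eqxx square_class0 square_class_sqr ?one0.
- rewrite (@sigE _ _ _ _ _ _ _ _ 0 0 0 0 0 (2 ^+ 2 * eps));
    try (split; ring); try ring.
  by rewrite eqxx square_class0 square_class_eps.
- rewrite (@sigE _ _ _ _ _ _ _ _ 0 0 0 0 0 0);
    try (split; ring); try ring.
  by rewrite eqxx square_class0.
- rewrite (@sigE _ _ _ _ _ _ _ _ 1 0 0 0 0 0);
    try (split; ring); try ring.
  by rewrite one0 square_class0.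
- rewrite (@sigE _ _ _ _ _ _ _ _ 1 0 0 0 0 (1 ^+ 2));
    try (split; ring); try ring.
  by rewrite one0 square_class0 square_class_sqr ?one0.
- exists (square_class (1 + 4 * b)).
  rewrite (@sigE _ _ _ _ _ _ _ _ 0 1 1 0 (1 ^+ 2) (1 + 4 * b));
    try (split; ring); try ring.
  by rewrite one0 andbF square_class_sqr ?one0.
- exists (square_class 1).
  rewrite (@sigE _ _ _ _ _ _ _ _ 0 1 1 0 (1 ^+ 2) 1);
    try (split; ring); try ring.
  by rewrite one0 andbF square_class_sqr ?one0.
case: (nm c) => n m.
exists (square_class (4 * eps * (1 - (n ^+ 2 - eps * m ^+ 2)))).
rewrite (@sigE _ _ _ _ _ _ _ _ 2 0 0 (- 2 * eps) (2 ^+ 2 * eps)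
  (4 * eps * (1 - (n ^+ 2 - eps * m ^+ 2))));
    try (split; ring); try ring.
by rewrite (negPf two_neq0) square_class_eps.
Qed.

(** The invariant ratio is cross-multiplied, as the determinant may vanish. *)
Lemma disc_ratio_congruent A B : pair_congruent A B ->
  \det (symmetric_part A) * disc B = \det (symmetric_part B) * disc A.
Proof. by move=> /pair_congruent_covariants[_ _ [r _ [-> ->]]]; ring. Qed.

(** On this family the discriminant and the determinant of the symmetric part both vanish; [t] is
    recovered from the ratio t + 1 : t through [has_asymmetry]. *)
Lemma odd_rank1_inj t t' :
  pair_congruent (E11, mx2 0 (t + 1) t 0) (E11, mx2 0 (t' + 1) t' 0) -> t = t'.
Proof.
have asymE k l s : k != l -> has_asymmetry k l (E11, mx2 0 (s + 1) s 0) ->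
    k * s = l * (s + 1).
  move=> kl [v v0 [/= /rowP/(_ 0) v1 /rowP/(_ 0)]].
  move: v1; rewrite !mx2T !mxE !big_ord_recl !big_ord0 !mxE /=.
  rewrite (_ : lift 0 0 = 1); last exact: val_inj.
  rewrite !mulr0 !addr0 mulr1 add0r => /eqP.
  rewrite -subr_eq0 -mulrBl mulf_eq0 subr_eq0 (negPf kl) /= => /eqP v00 e.
  have v01 : v 0 1 != 0.
    apply: contra v0 => /eqP v01; apply/eqP/rowP; case=> [[|[|i]] // hi].
      by rewrite mxE -[RHS]v00; congr (v _ _); apply: val_inj.
    by rewrite mxE -[RHS]v01; congr (v _ _); apply: val_inj.
  by apply: (mulfI v01); rewrite mulrCA e mulrCA add0r.
move=> tt'; have : has_asymmetry (t' + 1) t' (E11, mx2 0 (t + 1) t 0).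
  apply: has_asymmetry_congruent tt' _; exists (delta_mx 0 1).
    by apply/eqP=> /rowP/(_ 1)/eqP; rewrite !mxE oner_eq0.
  split; apply/rowP; case=> [[|[|i]] // hi];
  rewrite !mx2T !mxE !big_ord_recl !big_ord0 !mxE /=; ring.
move=> /asymE; rewrite -subr_eq0 addrAC subrr add0r oner_eq0 => /(_ isT).
move=> e; have -> : t = (t' + 1) * t - t' * t by ring.
by rewrite e; ring.
Qed.

(** The discriminant 1 + 4b recovers [b]. The value 1 is shared by [Some 0] and [None], and only the
    span of [None] contains the alternating matrix. *)
Lemma odd_hyperbolic_inj i j :
  pair_congruent (noncommutative_rep (inl (inr i)))
                 (noncommutative_rep (inl (inr j))) -> i = j.
Proof.
have discE b c : pair_congruent (H, mx2 1 1 0 b) (H, mx2 1 1 0 c) -> b = c.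
  move/disc_ratio_congruent; rewrite /symmetric_part /disc /skew_coef /=.
  rewrite -!scaleNr !mx2_entries !mx2_simp => e; apply: (mulfI four_neq0).
  apply/eqP; rewrite -subr_eq0; apply/eqP.
  move/eqP: e; rewrite -subr_eq0 => /eqP; apply: etrans; ring.
have noJ b : ~ pair_congruent (H, mx2 0 1 0 0) (H, mx2 1 1 0 b).
  move=> Hb; have [x [y]] : has_alternating (H, mx2 1 1 0 b).
    apply: has_alternating_congruent Hb _; exists (-1), 2.
    by rewrite !mx2_simp; congr mx2; ring.
  rewrite !mx2_simp => /mx2_inj[/= e1 e2 e3 _].
  have y0 : y = 0 by rewrite -e1; ring.
  have /eqP : (2 : F) = 0.
    transitivity ((x * 1 + y * 1) - (x * 1 + y * 0)); last by rewrite y0; ring.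
    by rewrite e2 e3; ring.
  by rewrite (negPf two_neq0).
by case: i j => [b|] [c|] //= => [/discE-> | /pair_congruent_sym/noJ | /noJ].
Qed.

(** The symmetric part has determinant -4 eps for every [c], while the discriminant is 4 eps (1 -
    c). *)
Lemma odd_anisotropic_inj c c' :
  pair_congruent (noncommutative_rep (inr c)) (noncommutative_rep (inr c')) ->
  c = c'.
Proof.
rewrite /= -{2}(nmP c) -{2}(nmP c'); case: (nm c) (nm c') => n m [n' m'] /=.
move/disc_ratio_congruent; rewrite /symmetric_part /disc /skew_coef /=.
rewrite -!scaleNr !mx2_entries !mx2_simp => /esym e.
have e16 : 4 * (4 * eps ^+ 2) != 0 by rewrite !mulf_neq0 ?expf_neq0.
apply: (mulfI e16); apply/eqP; rewrite -subr_eq0; apply/eqP.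
move/eqP: e; rewrite -subr_eq0 => /eqP; apply: etrans; ring.
Qed.

Lemma odd_classifies : classifies odd_rep.
Proof.
split.
- exact: odd_rep_independent.
- move=> i j ij; have := signature_rep i; have := signature_rep j.
  rewrite (signature_congruent ij); move: ij.
  (* Signatures leave only the cases where both indices lie in one family; there the parameter is
     recovered. *)
  case: i j => [[[]|] | [[[t|]|i]|c]] [[[]|] | [[[t'|]|j]|c']] ij;
    try (by move=> ->); try (by case=> D ->); try (by move=> -> [D]);
    try (by case=> D -> [D']) => _ _.
  + by rewrite (odd_rank1_inj ij).
  + by rewrite (odd_hyperbolic_inj ij).
  by rewrite (odd_anisotropic_inj ij).
- move=> A iA.
  have [sA | nsA] : symmetric_pair A \/ ~ symmetric_pair A.
    rewrite /symmetric_pair.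
    have [e1 | /eqP e1] := eqVneq A.1^T A.1; last by right=> -[].
    by have [e2 | /eqP e2] := eqVneq A.2^T A.2; [left | right=> -[]].
  + by have [i Ai] := odd_symmetric iA sA; exists (inl i).
  by have [i Ai] := odd_nonsymmetric iA nsA; exists (inr i).
exact: odd_rep_symmetric.
Qed.

End Odd.

(** * Nonsquares and norms over finite fields *)

Lemma exists_nonsquare (F : finFieldType) : (2 : F) != 0 ->
  exists eps : F, (forall x, x ^+ 2 != eps)
    /\ (forall a, exists x, a = x ^+ 2 \/ a = eps * x ^+ 2).
Proof.
move=> two_neq0.
(* A generator is the nonsquare: the parity of the exponent yields the dichotomy, and if it were a
   square, squaring would be onto, hence injective, against (-1)^2 = 1. *)
have /cyclicP[g gE] := field_unit_group_cyclic [set: {unit F}].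
have sqP a : exists x, a = x ^+ 2 \/ a = val g * x ^+ 2.
  have [-> | a0] := eqVneq a 0; first by exists 0; left; rewrite expr0n.
  have ua : a \is a GRing.unit by rewrite unitfE.
  have : FinRing.unit F ua \in <[g]>%g by rewrite -gE inE.
  case/cycleP=> k /(congr1 val) /=; rewrite FinRing.val_unitX => ->.
  exists (val g ^+ k./2); rewrite -exprM muln2 -[in val g ^+ k](odd_double_half k).
  by case: (odd k); [right; rewrite add1n exprS | left; rewrite add0n].
exists (val g); split=> // x; apply/eqP=> xg.
have sq_surj (a : F) : exists y, y ^+ 2 = a.
  have [y [] ->] := sqP a; first by exists y.
  by exists (x * y); rewrite exprMn xg.
have [h hK] := fin_all_exists sq_surj.
have h_inj : injective h by apply: (can_inj (g := fun y : F => y ^+ 2)).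
have sq_inj : cancel (fun y : F => y ^+ 2) h.
  exact: (bij_can_sym (injF_bij h_inj) _).2 hK.
have /eqP : (1 : F) = -1 by apply: (can_inj sq_inj); rewrite sqrrN.
by rewrite -subr_eq0 opprK (negPf two_neq0).
Qed.

(* If the norm form only took square values, then - eps would be a square, so
   the squares would be closed under addition and would exhaust F_p. *)
Lemma norm_surjective (p : nat) (eps : 'F_p) :
  (forall x, x ^+ 2 != eps) ->
  (forall a, exists x, a = x ^+ 2 \/ a = eps * x ^+ 2) ->
  exists nm : 'F_p -> 'F_p * 'F_p,
    forall c, (nm c).1 ^+ 2 - eps * (nm c).2 ^+ 2 = c.
Proof.
move=> nsq sqP.
suff ex_nm c : exists nm : 'F_p * 'F_p, nm.1 ^+ 2 - eps * nm.2 ^+ 2 = c.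
  by have [nm nmP] := fin_all_exists ex_nm; exists nm.
have [/existsP[[u v] /existsP[w /andP[w0 /eqP uvw]]] | N] :=
  boolP [exists uv : 'F_p * 'F_p, exists w,
           (w != 0) && (uv.1 ^+ 2 - eps * uv.2 ^+ 2 == eps * w ^+ 2)].
  have [x [] ->] := sqP c; first by exists (x, 0); rewrite expr0n mulr0 subr0.
  exists (x * u / w, x * v / w); rewrite /= in uvw *.
  transitivity ((x / w) ^+ 2 * (u ^+ 2 - eps * v ^+ 2)); first by field.
  by rewrite uvw; field.
have sqN u v : exists x, u ^+ 2 - eps * v ^+ 2 = x ^+ 2.
  have [x [] e] := sqP (u ^+ 2 - eps * v ^+ 2); first by exists x.
  move/existsPn/(_ (u, v))/existsPn/(_ x): N; rewrite /= e eqxx andbT negbK.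
  by move=> /eqP->; exists 0; rewrite !expr0n mulr0.
have [r] := sqN 0 1; rewrite expr0n expr1n mulr1 sub0r => epsE.
have r0 : r != 0.
  apply: contra (nsq 0) => /eqP r0; move/eqP: epsE.
  by rewrite r0 expr0n oppr_eq0 => /eqP->.
(* As - eps = r^2, the sum x^2 + 1 is the norm x^2 - eps (1 / r)^2, again a square. *)
have natsq n : exists x : 'F_p, n%:R = x ^+ 2.
  elim: n => [|n [x nx]]; first by exists 0; rewrite expr0n.
  have [y xy] := sqN x r^-1; exists y.
  by rewrite -natr1 nx -xy -mulNr epsE -exprMn mulfV ?expr1n.
by have [x ex] := natsq (nat_of_ord eps); case/eqP: (nsq x); rewrite -ex -F_pE.
Qed.

Lemma odd_prime_classifies (p : nat) : prime p -> p != 2 ->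
  exists rep : option bool + (option 'F_p + option 'F_p + 'F_p)
      -> 'M['F_p]_2 * 'M['F_p]_2,
    classifies rep.
Proof.
move=> hp p2; have two_neq0 : (2 : 'F_p) != 0.
  by rewrite -(dvdn_pcharf (pchar_Fp hp)) dvdn_prime2.
have [eps [nsq sqP]] := exists_nonsquare two_neq0.
have [nm nmP] := norm_surjective nsq sqP.
by exists (odd_rep eps nm); apply: odd_classifies.
Qed.

(** * Characteristic two *)

Section Two.

Local Notation quad := (bool * bool * bool * bool)%type.

Let inF (b : bool) : 'F_2 := b%:R.

Let inFD a b : inF (a (+) b) = inF a + inF b.
Proof. by case: a b => [] []; apply: val_inj. Qed.

Let inFM a b : inF (a && b) = inF a * inF b.
Proof. by case: a b => [] []; apply: val_inj. Qed.

Let inF_inj : injective inF.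
Proof. by move=> [] [] // /(congr1 val). Qed.

Let inF_surj x : exists b, x = inF b.
Proof.
by case: x => [[|[|x]] // hx]; [exists false | exists true]; apply: val_inj.
Qed.

(** Matrices over F_2 are encoded by booleans, with exclusive or as sum and conjunction as product,
    so that congruence can be decided by evaluation. *)
Definition mx_of_quad (A : quad) : 'M['F_2]_2 :=
  let: (a, b, c, d) := A in mx2 (inF a) (inF b) (inF c) (inF d).

Definition quad_act (C A : quad) : quad :=
  let: (p, q, r, s) := C in let: (a, b, c, d) := A in
  let f x1 x2 y1 y2 := (x1 && a && y1) (+) (x1 && b && y2)
    (+) (x2 && c && y1) (+) (x2 && d && y2) in
  (f p q p q, f p q r s, f r s p q, f r s r s).

Definition quad_comb (x y : bool) (A B : quad) : quad :=
  let: (a, b, c, d) := A in let: (a', b', c', d') := B in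
  let f u v := (x && u) (+) (y && v) in
  (f a a', f b b', f c c', f d d').

Definition quad_unit (C : quad) : bool :=
  let: (a, b, c, d) := C in (a && d) (+) (b && c).

Definition bools := [:: false; true].
Definition quads : seq quad :=
  [seq (abc, d) | abc <- [seq (ab, c) | ab <- [seq (a, b) | a <- bools, b <- bools],
                                        c <- bools], d <- bools].

Definition quad_congruent (A B : quad * quad) : bool :=
  has (fun C => quad_unit C && has (fun G : quad =>
    let: (g, h, k, l) := G in
    [&& quad_unit G, quad_act C A.1 == quad_comb g h B.1 B.2
      & quad_act C A.2 == quad_comb k l B.1 B.2]) quads) quads.

(** Over F_2 the nontrivial combinations are the two members and their sum. *)
Definition quad_independent (A : quad * quad) : bool :=
  let z := (false, false, false, false) in
  [&& A.1 != z, A.2 != z & A.1 != A.2].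

Definition quad_symmetric (A : quad * quad) : bool :=
  let: (_, b, c, _) := A.1 in let: (_, b', c', _) := A.2 in
  (b == c) && (b' == c').

Definition mx_pair (A : quad * quad) := (mx_of_quad A.1, mx_of_quad A.2).

Let mem_quads A : A \in quads.
Proof. by move: A => [[[[] []] []] []]. Qed.

Lemma mx_of_quad_inj : injective mx_of_quad.
Proof.
move=> [[[a b] c] d] [[[a' b'] c'] d'] /mx2_inj.
by move=> [/inF_inj-> /inF_inj-> /inF_inj-> /inF_inj->].
Qed.

Lemma mx_of_quad_surj M : exists A, M = mx_of_quad A.
Proof.
rewrite [M]mx2E; have [a ->] := inF_surj (M 0 0); have [b ->] := inF_surj (M 0 1).
have [c ->] := inF_surj (M 1 0); have [d ->] := inF_surj (M 1 1).
by exists (a, b, c, d).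
Qed.

Lemma mx_of_quad_act C A :
  mx_of_quad C *m mx_of_quad A *m (mx_of_quad C)^T = mx_of_quad (quad_act C A).
Proof.
case: C A => [[[p q] r] s] [[[a b] c] d]; rewrite /mx_of_quad !mx2_simp.
by congr mx2; rewrite !(inFD, inFM); ring.
Qed.

Lemma mx_of_quad_comb x y A B : inF x *: mx_of_quad A + inF y *: mx_of_quad B =
  mx_of_quad (quad_comb x y A B).
Proof.
case: A B => [[[a b] c] d] [[[a' b'] c'] d'].
by rewrite /mx_of_quad !mx2_simp; congr mx2; rewrite !(inFD, inFM).
Qed.

Lemma mx_of_quad_unit C : (mx_of_quad C \in unitmx) = quad_unit C.
Proof.
case: C => [[[a b] c] d]; rewrite unitmxE det_mx2 unitfE.
by case: a b c d => [] [] [] [].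
Qed.

Lemma quad_congruentP A B : reflect (pair_congruent (mx_pair A) (mx_pair B))
  (quad_congruent A B).
Proof.
apply: (iffP hasP) => [[C _ /andP[uC]] |].
  move=> /hasP[[[[g h] k] l] _ /and3P[uG /eqP A1 /eqP A2]].
  exists (mx_of_quad C), (mx_of_quad (g, h, k, l)); rewrite !mx_of_quad_unit.
  by split=> //=; rewrite !mx_of_quad_act ?A1 ?A2 !mx2_entries mx_of_quad_comb.
move=> [C [G []]]; have [{}C ->] := mx_of_quad_surj C.
have [{}G ->] := mx_of_quad_surj G; rewrite !mx_of_quad_unit !mx_of_quad_act.
case: G => [[[g h] k] l] uC uG.
rewrite -[mx_of_quad (g, h, k, l)]/(mx2 (inF g) (inF h) (inF k) (inF l)) !mx2_entries.
rewrite !mx_of_quad_comb.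
move=> /mx_of_quad_inj A1 /mx_of_quad_inj A2; exists C => //; rewrite uC.
by apply/hasP; exists (g, h, k, l); rewrite // uG A1 A2 !eqxx.
Qed.

Lemma quad_independentP A :
  reflect (independent (mx_pair A)) (quad_independent A).
Proof.
pose z := (false, false, false, false).
have z0 : mx_of_quad z = 0 by rewrite mx2_0.
apply: (iffP and3P) => [[A1 A2 A12] x y | iA].
  have [{}x ->] := inF_surj x; have [{}y ->] := inF_surj y.
  rewrite mx_of_quad_comb -z0 => /mx_of_quad_inj.
  move: A1 A2 A12; case: A => [[[[a b] c] d] [[[a' b'] c'] d']] /=.
  by case: x y => [] []; move: a b c d a' b' c' d' => [] [] [] [] [] [] [] [].
have iA' x y : mx_of_quad (quad_comb x y A.1 A.2) = 0 -> ~~ x && ~~ y.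
  by rewrite -mx_of_quad_comb => /iA[/(@inF_inj _ false)-> /(@inF_inj _ false)->].
split; apply/eqP=> A0; case: A {iA} A0 iA' => [A1 A2] /= A0 iA'.
- by have := iA' true false; rewrite A0;
    case: A2 {A0 iA'} => [[[[] []] []] []] /(_ z0).
- by have := iA' false true; rewrite A0;
    case: A1 {A0 iA'} => [[[[] []] []] []] /(_ z0).
by have := iA' true true; rewrite A0;
  case: A2 {A0 iA'} => [[[[] []] []] []] /(_ z0).
Qed.

Lemma quad_symmetricP A :
  symmetric_pair (mx_pair A) <-> quad_symmetric A.
Proof.
case: A => [[[[a b] c] d] [[[a' b'] c'] d']].
rewrite /symmetric_pair /= !mx2T; split.
  case=> /mx2_inj[_ /inF_inj e _ _] /mx2_inj[_ /inF_inj e' _ _].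
  by apply/andP; split; apply/eqP.
by case/andP=> /eqP-> /eqP->.
Qed.

(** Allows the representatives to be listed by entries 0 and 1. *)
Definition quad_of (a b c d : nat) : quad := (a == 1, b == 1, c == 1, d == 1)%N.

Definition two_reps : seq (quad * quad) :=
  [:: (quad_of 1 0 0 0, quad_of 0 1 1 0);
      (quad_of 1 0 0 0, quad_of 0 0 0 1);
      (quad_of 0 1 1 1, quad_of 1 0 0 1);
      (quad_of 0 0 0 1, quad_of 0 0 1 0);
      (quad_of 0 0 0 1, quad_of 0 1 0 0);
      (quad_of 0 0 0 1, quad_of 1 0 1 0);
      (quad_of 0 0 1 0, quad_of 0 1 0 0);
      (quad_of 0 0 1 0, quad_of 0 1 0 1);
      (quad_of 0 0 1 0, quad_of 1 0 0 1);
      (quad_of 0 1 1 0, quad_of 1 0 1 1)]%N.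

Let two_rep_quad (i : 'I_3 + 'I_7) : quad * quad :=
  let n : nat := match i with inl i => i | inr i => (3 + i)%N end in
  nth (quad_of 0 0 0 0, quad_of 0 0 0 0)%N two_reps n.

Lemma two_classifies : classifies (fun i => mx_pair (two_rep_quad i)).
Proof.
pose r n := nth (quad_of 0 0 0 0, quad_of 0 0 0 0)%N two_reps n.
pose idx (i : 'I_3 + 'I_7) : nat := match i with inl i => i | inr i => (3 + i)%N end.
have idxP i : idx i \in iota 0 10.
  by rewrite mem_iota; case: i => i /=; have := ltn_ord i; lia.
have idx_inj : injective idx.
  move=> [i|i] [j|j] /= ij; first by congr inl; apply: val_inj.
  - by have := ltn_ord i; rewrite ij ltnNge leq_addr.
  - by have := ltn_ord j; rewrite -ij ltnNge leq_addr.
  by congr inr; apply: val_inj => /=; lia.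
split.
- move=> i; apply/quad_independentP.
  have /allP : all (fun n => quad_independent (r n)) (iota 0 10) by vm_compute.
  by move/(_ _ (idxP i)).
- move=> i j /quad_congruentP ij; apply: idx_inj; apply/eqP.
  have /allrelP : allrel (fun m n => quad_congruent (r m) (r n) ==> (m == n))
    (iota 0 10) (iota 0 10) by vm_compute.
  by move=> /(_ _ _ (idxP i) (idxP j))/implyP; apply.
- move=> [A1 A2]; have [{}A1 ->] := mx_of_quad_surj A1.
  have [{}A2 ->] := mx_of_quad_surj A2 => /(@quad_independentP (A1, A2)) iA.
  (* All 16 x 16 pairs of matrices are examined. *)
  have /allrelP : allrel (fun B1 B2 => quad_independent (B1, B2) ==>
     has (fun n => quad_congruent (B1, B2) (r n)) (iota 0 10)) quads quads.
    by vm_compute.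
  move=> /(_ _ _ (mem_quads A1) (mem_quads A2))/implyP/(_ iA)/hasP[n].
  rewrite mem_iota /= => n10 /quad_congruentP An.
  have [n3 | n3] := ltnP n 3; first by exists (inl (Ordinal n3)).
  have n7 : (n - 3 < 7)%N by lia.
  by exists (inr (Ordinal n7)); rewrite -[two_rep_quad _]/(r (3 + (n - 3))%N) subnKC.
move=> i; rewrite quad_symmetricP.
have /allP : all (fun n => quad_symmetric (r n) == (n < 3)%N) (iota 0 10).
  by vm_compute.
move=> /(_ _ (idxP i))/eqP ->; case: i => i /=; last by split; have := ltn_ord i; lia.
by rewrite ltn_ord.
Qed.

End Two.

Local Close Scope ring_scope.

Theorem proposition5p8 (p lam : nat) (hp : prime p) :
  let n := (1 + 2 + 2 + lam)%N in
  let N := (if p == 2 then 10 else 3 * p + 5)%N in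
  [/\ num_iso_classes (fun R => ring_class p n 2 2 lam R) N,
      num_iso_classes
        (fun R => ring_class p n 2 2 lam R /\ commutative_ring R) 3
    & num_iso_classes
        (fun R => ring_class p n 2 2 lam R /\ ~ commutative_ring R) (N - 3)%N].
Proof.
move=> n N; rewrite /N /n; have [p2 | p2] := boolP (p == 2).
  have e2 := eqP p2; subst p.
  have := classifies_num_iso_classes lam hp two_classifies.
  by rewrite !card_ord.
have [rep repP] := odd_prime_classifies hp p2.
have := classifies_num_iso_classes lam hp repP.
rewrite !card_sum !card_option card_bool card_Fp //.
have -> : (2.+1 + (p.+1 + p.+1 + p) = 3 * p + 5)%N by lia.
by have -> : (p.+1 + p.+1 + p = 3 * p + 5 - 3)%N by lia.
Qed.
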